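(* Let $\sigma=(\sigma_j)_{j\in\mathbb N}$ be a non-increasing sequence of non-negative real numbers with $\sigma_n\asymp n^{-\alpha}\ln^{-\beta}(n+1)$ for some $\alpha\ge 0$ and $\beta\in\mathbb R$ (where $\beta\ge 0$ if $\alpha=0$). Then $$\mathbb E[\mathcal R_n(\sigma)]\asymp\begin{cases}\sigma_1 & \text{if } \alpha<1/2 \text{ or } \beta\le\alpha=1/2,\\[1mm] \sigma_{n+1}\sqrt{\ln(n+1)} & \text{if } \beta>\alpha=1/2,\\[1mm] \sigma_{n+1} & \text{if } \alpha>1/2.\end{cases}$$
   Context: For sequences $(a_n)_{n\in\mathbb N}$, $(b_n)_{n\in\mathbb N}$ write $a_n\preccurlyeq b_n$ if there is a constant $C>0$ with $a_n\le C\,b_n$ for all $n\in\mathbb N$, and $a_n\asymp b_n$ if both $a_n\preccurlyeq b_n$ and $b_n\preccurlyeq a_n$. Convention: $a/0=\infty$ for $a>0$ and $0/0=0$. Put $H_\sigma=\{x\in\ell_2:\sum_{j\in\mathbb N}(x_j/\sigma_j)^2<\infty\}$ and $\mathcal E_\sigma=\{x\in\ell_2:\sum_{j\in\mathbb N}(x_j/\sigma_j)^2\le 1\}$. $G_n=(g_{ij})_{1\le i\le n,\,j\in\mathbb N}$ is a random matrix with independent standard Gaussian entries, and $G_nx=(\sum_{j}g_{ij}x_j)_{i=1}^n$, where a component is assigned the value NaN if its series does not converge. The radius of random information is $$\mathcal R_n(\sigma)=\inf_{\phi}\ \sup_{x\in\mathcal E_\sigma}\|\phi(G_nx)-x\|_2,$$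 the infimum being over all mappings $\phi$ from the image of $G_n$ (on $H_\sigma$) to $\ell_2$. *)

(* Defs.v *)
(* Sequences indexed by {1, 2, ...} are functions on nat shifted by one: the
   value of x : nat -> R at j is the mathematical x_{j+1}.  So (sigma 0) is
   sigma_1 and (sigma n) is sigma_{n+1}.  The number n of measurements is not
   shifted. *)
From HB Require Import structures.
From mathcomp Require Import all_boot all_order all_algebra.
From mathcomp Require Import all_classical all_reals all_analysis.

Set Implicit Arguments.
Unset Strict Implicit.
Unset Printing Implicit Defensive.

Import Order.TTheory GRing.Theory Num.Theory.
Import numFieldNormedType.Exports.

Local Open Scope classical_set_scope.
Local Open Scope ring_scope.

Definition preccurly (R : realType) (a b : nat -> \bar R) : Prop :=
  exists2 C : R, 0 < C & forall n : nat, (0 < n)%N -> (a n <= C%:E * b n)%E.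

Definition asymp (R : realType) (a b : nat -> \bar R) : Prop :=
  preccurly a b /\ preccurly b a.

Definition norm2 (R : realType) (x : nat -> R) : \bar R :=
  'N[@counting nat R]_2%:E [EFin \o x].

Definition ell2 (R : realType) : set (nat -> R) :=
  [set x | finite_norm (@counting nat R) 2%:E x].

(* The inverse of 0 in \bar R is +oo and 0 * +oo = 0, so this division gives
   a / 0 = +oo for a > 0 and 0 / 0 = 0. *)
Definition weighted_sum (R : realType) (sigma x : nat -> R) : \bar R :=
  (\sum_(0 <= j <oo) ((x j)%:E / (sigma j)%:E) ^+ 2)%E.

Definition Hspace (R : realType) (sigma : nat -> R) : set (nat -> R) :=
  [set x | @ell2 R x /\ (weighted_sum sigma x < +oo)%E].

Definition ellipsoid (R : realType) (sigma : nat -> R) : set (nat -> R) :=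
  [set x | @ell2 R x /\ (weighted_sum sigma x <= 1)%E].

(* None is the value NaN. *)
Definition info (R : realType) (n : nat) (g : 'I_n -> nat -> R)
    (x : nat -> R) : 'I_n -> option R :=
  fun i => let s := series (fun j => g i j * x j) in
           if pselect (cvgn s) then Some (limn s) else None.

(* phi is a total function whose values off the image of info g are
   irrelevant. *)
Definition recovery_map (R : realType) (n : nat) (sigma : nat -> R)
    (g : 'I_n -> nat -> R) : set (('I_n -> option R) -> (nat -> R)) :=
  [set phi | forall y, (info g @` Hspace sigma) y -> @ell2 R (phi y)].

Definition radius_of_information (R : realType) (n : nat) (sigma : nat -> R)
    (g : 'I_n -> nat -> R) : \bar R :=
  ereal_inf [set ereal_sup [set norm2 (phi (info g x) \- x)
                           | x in ellipsoid sigma]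
            | phi in recovery_map sigma g].

Definition mutually_independent (d d' : measure_display)
    (T : measurableType d) (T' : measurableType d') (R : realType)
    (P : probability T R) (I : eqType) (X : I -> {RV P >-> T'}) : Prop :=
  forall (s : seq I) (B : I -> set T'), uniq s ->
    (forall i, measurable (B i)) ->
    P (\big[setI/setT]_(i <- s) (X i @^-1` B i)) =
    (\prod_(i <- s) P (X i @^-1` B i))%E.

Definition gaussian_matrix (d : measure_display) (T : measurableType d)
    (R : realType) (P : probability T R) (n : nat)
    (g : 'I_n -> nat -> {RV P >-> R}) : Prop :=
  (forall i j (A : set R), measurable A ->
     distribution P (g i j) A = normal_prob 0 1 A) /\
  mutually_independent (fun ij : 'I_n * nat => g ij.1 ij.2).

(* The radius takes values in [0, sigma_1] and is only almost everywhere equal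
   to a measurable function of w; the integral of such a nonnegative function
   is its expectation ('E_P[_] takes real-valued functions only). *)
Definition expected_radius (d : measure_display) (T : measurableType d)
    (R : realType) (P : probability T R) (n : nat) (sigma : nat -> R)
    (g : 'I_n -> nat -> {RV P >-> R}) : \bar R :=
  (\int[P]_w radius_of_information sigma (fun i j => g i j w))%E.

(* Main.v *)
(* Up to a factor 2 the radius is the supremum of |x| over the x in the ellipsoid
   with G x = 0.  Everything rests on one estimate: if q >= K p, the p x q blocks
   A of the Gaussian matrix satisfy c q |u|^2 <= |A^T u|^2 <= C q |u|^2 for all u,
   outside an event of probability at most 2 exp(- del q).  It follows from the
   moment generating function of linear forms of the entries and a union bound
   over lattice nets.

   Upper bound: let k = n / K and cut the columns beyond K n at K n 2^l.  The block
   estimates give |G x_(>k)|^2 <= C n (sigma_(k+1)^2 + sum_l 2^l sigma_(K n 2^l)^2)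
   on the ellipsoid, and G x = 0 implies c n |x_(<=k)|^2 <= |G x_(>k)|^2.
   Lower bound: the Gram matrix of the weighted columns beyond K n is at least
   c n sum_l 2^l sigma_(K n 2^l)^2, so that solving a linear system yields a kernel
   vector in the ellipsoid with a large first coordinate.
   In each regime the dyadic sums have the required order of magnitude. *)
Require Import Defs.
From HB Require Import structures.
From mathcomp Require Import all_boot all_order all_algebra.
From mathcomp Require Import all_classical all_reals all_analysis.
From mathcomp Require Import measurable_realfun zify ring lra.

Set Implicit Arguments.
Unset Strict Implicit.
Unset Printing Implicit Defensive.

Import Order.TTheory GRing.Theory Num.Theory.
Import numFieldNormedType.Exports.

Local Open Scope classical_set_scope.
Local Open Scope ring_scope.

(** * Densities, independence and moment generating functions *)

(** The lower tail is the obstacle. |A^T u| is rarely small because exp(-2 |A^T u|^2) has a small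
    mean, but exp(-2 y^2) is not a combination of exponentials and only moment generating functions
    of linear forms are at hand. It is therefore dominated by such a combination whose Gaussian mean
    is still below 1. The block estimate is used in two directions: n rows against many columns for
    the tail, and transposed, k columns against n rows, for the head. The factor K between the sides
    pays for the nets; it only shifts indices by a constant factor, under which sigma changes by a
    constant factor. All dyadic blocks can be controlled on one event, since their lengths double
    and their failure probabilities are summable. The total failure probability is exponentially
    small in n, while sigma decays at most polynomially up to logarithms, so the trivial bound
    sigma_1 on the bad event costs only a constant. The lower bound asks for a good event of
    probability 1/2, and there the number of dyadic blocks is free and may depend on n; this yields
    the order sigma_1 when the dyadic sums diverge. *)

Section density.
Local Open Scope ereal_scope.
Import HBNNSimple.
Context d1 d2 (X : measurableType d1) (Y : measurableType d2) (R : realType).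
Variables (phi : X -> Y) (mphi : measurable_fun setT phi).
Variables (mu : {measure set X -> \bar R}) (nu : {measure set Y -> \bar R}).
Variables (Z : X -> R).
Hypothesis mZ : measurable_fun setT Z.
Hypothesis Z0 : forall x, (0 <= Z x)%R.
Hypothesis nuE : forall A, measurable A ->
  nu A = \int[mu]_x ((\1_A (phi x) * Z x)%R)%:E.

(** True for indicators by [nuE], hence for simple functions, hence for [f] by monotone convergence.
    It serves twice: with [phi] one of the independent variables and [Z] the product of the other
    factors, and with [phi] the identity and [Z] the normal density. *)
Lemma ge0_integral_density (f : Y -> \bar R) :
  measurable_fun setT f -> (forall y, 0 <= f y) ->
  \int[nu]_y f y = \int[mu]_x (f (phi x) * (Z x)%:E).
Proof.
move=> mf f0; pose f_ := nnsfun_approx measurableT mf.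
have mfZ n : measurable_fun setT (fun x => ((f_ n (phi x) * Z x)%R)%:E).
  apply/measurable_EFinP; apply: measurable_funM => //.
  by apply: measurableT_comp.
transitivity (limn (fun n => \int[nu]_x (f_ n x)%:E)).
  rewrite -monotone_convergence//.
  - apply: eq_integral => y _; apply/esym/cvg_lim => //.
    by apply: cvg_nnsfun_approx => // *; apply: f0.
  - by move=> n; exact/measurable_EFinP/measurable_funP.
  - by move=> n y _; rewrite lee_fin.
  - by move=> y _ m n mn; rewrite lee_fin; exact/lefP/nd_nnsfun_approx.
rewrite [X in limn X](_ : _ = fun n => \int[mu]_x ((f_ n (phi x) * Z x)%R)%:E).
  rewrite -monotone_convergence//; last 2 first.
  - by move=> n y _; rewrite lee_fin mulr_ge0.
  - move=> y _ m n mn; rewrite lee_fin ler_wpM2r//.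
    exact/lefP/nd_nnsfun_approx.
  apply: eq_integral => x _; apply/cvg_lim => //.
  under eq_fun do rewrite EFinM.
  apply: cvgeZr => //; apply: cvg_nnsfun_approx => // *; exact: f0.
apply/funext => n.
transitivity (\sum_(k \in range (f_ n)) (k%:E * nu (f_ n @^-1` [set k]))).
  by rewrite integralT_nnsfun sintegralE.
rewrite (_ : (fun x => _) = fun x => \sum_(k \in range (f_ n))
    ((k * (\1_(f_ n @^-1` [set k]) (phi x) * Z x))%R)%:E); last first.
  apply/funext => x; rewrite [in LHS]fimfunE mulr_fsuml -fsumEFin//.
  by apply: eq_fsbigr => k _; rewrite mulrA.
rewrite ge0_integral_fsum//; last 2 first.
- move=> k; apply/measurable_EFinP; apply: measurable_funM => //.
  by apply: measurable_funM => //; apply: measurableT_comp.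
- move=> k x _; rewrite mulrA EFinM mule_ge0 ?lee_fin//.
  exact: nnfun_muleindic_ge0.
apply: eq_fsbigr => k /[!inE] -[y _ <-].
rewrite nuE// -ge0_integralZl//.
- by apply/measurable_EFinP; apply: measurable_funM => //;
    apply: measurableT_comp.
- by move=> x _; rewrite lee_fin mulr_ge0.
- by rewrite lee_fin.
Qed.
End density.

Section independence.
Context d (T : measurableType d) (R : realType) (P : probability T R).
Variables (I : eqType) (X : I -> {RV P >-> R}).
Hypothesis indX : mutually_independent X.

Lemma measurable_prod_comp (s : seq I) (f : I -> R -> R) :
  (forall i, measurable_fun setT (f i)) ->
  measurable_fun setT (fun w => \prod_(i <- s) f i (X i w)).
Proof.
move=> mf; apply: measurable_prod => i _.
by apply: measurableT_comp.
Qed.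

Lemma indic_bigsetI (s : seq I) (B : I -> set R) w :
  \1_(\big[setI/setT]_(i <- s) (X i @^-1` B i)) w =
  \prod_(i <- s) \1_(B i) (X i w) :> R.
Proof.
elim: s => [|i s IH]; first by rewrite !big_nil indicT.
by rewrite !big_cons -IH indicI.
Qed.

Lemma bigsetI_measurable (s : seq I) (B : I -> set R) :
  (forall i, measurable (B i)) ->
  measurable (\big[setI/setT]_(i <- s) (X i @^-1` B i)).
Proof.
move=> mB; apply: big_ind => //; first exact: measurableI.
by move=> i _; rewrite -[_ @^-1` _]setTI; exact: measurable_funP.
Qed.

Lemma preimage_measurable i A : measurable A -> measurable (X i @^-1` A).
Proof. by move=> mA; rewrite -[_ @^-1` _]setTI; exact: measurable_funP. Qed.

(* The factors of s1 are general functions and those of s2 are indicators, so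
   that the induction replaces one indicator at a time. *)
Lemma independent_integral_prod_indic (s1 s2 : seq I) (f : I -> R -> R)
    (B : I -> set R) (m : I -> R) :
  uniq (s1 ++ s2) ->
  (forall i, measurable_fun setT (f i)) -> (forall i x, 0 <= f i x) ->
  (forall i, measurable (B i)) ->
  (forall i, \int[P]_w (f i (X i w))%:E = (m i)%:E)%E ->
  (\int[P]_w ((\prod_(i <- s1) f i (X i w) *
               \prod_(i <- s2) \1_(B i) (X i w))%:E) =
   (\prod_(i <- s1) m i * \prod_(i <- s2) fine (P (X i @^-1` B i)))%:E)%E.
Proof.
move=> + mf f0 + fm; elim: s1 s2 B => [|i s IH] s2 B us mB.
  rewrite /= in us;   under eq_integral do rewrite big_nil mul1r -indic_bigsetI.
  rewrite integral_indic// ?setIT; last exact: bigsetI_measurable.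
  apply: (etrans (indX us mB)); rewrite big_nil mul1r -prodEFin.
  apply: eq_bigr => i _; rewrite fineK//.
  by apply: fin_num_measure; exact: preimage_measurable.
pose Z w := \prod_(j <- s) f j (X j w) * \prod_(j <- s2) \1_(B j) (X j w) : R.
have m1 A : measurable A -> measurable_fun setT (\1_A : R -> R) by [].
have mZ : measurable_fun setT Z.
  apply: measurable_funM; first exact: measurable_prod_comp.
  by apply: (@measurable_prod_comp s2 (fun j => \1_(B j))) => j; apply: m1.
have Z0 w : 0 <= Z w.
  apply: mulr_ge0; first exact: prodr_ge0.
  by apply: prodr_ge0 => j _; rewrite indicE.
have m0 j : 0 <= m j.
  by rewrite -lee_fin -fm integral_ge0// => w _; rewrite lee_fin.
pose c := \prod_(j <- s) m j * \prod_(j <- s2) fine (P (X j @^-1` B j)).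
have c0 : 0 <= c.
  by rewrite mulr_ge0// prodr_ge0// => j _; rewrite fine_ge0.
have /= [is2 us'] : i \notin s2 /\ uniq (s ++ i :: s2).
  move: us; rewrite /= mem_cat negb_or -andbA => /and3P[i1 i2 u12].
  split=> //; rewrite -cat_rcons cat_uniq.
  move: u12; rewrite cat_uniq => /and3P[u1 u2 u3].
  rewrite rcons_uniq i1 u1 u3 /= andbT.
  apply/hasPn => j js2; rewrite mem_rcons inE negb_or.
  move/hasPn : u2 => /(_ _ js2) -> ; rewrite andbT.
  by apply: contraNneq i2 => <-.
(* By the induction hypothesis with [\1_A] as the factor at [i], this multiple of the law of [X i]
   is the image under [X i] of the measure with density [Z]. Integrating [f i] against it replaces
   that indicator by [f i]. *)
pose nu : {measure set R -> \bar R} := mscale (NngNum c0) (distribution P (X i)).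
have nuE A : measurable A -> nu A = (\int[P]_w (\1_A (X i w) * Z w)%:E)%E.
  move=> mA.
  pose B' j := if j == i then A else B j.
  have B'i : B' i = A by rewrite /B' eqxx.
  have B's2 j : j \in s2 -> B' j = B j.
    by rewrite /B'; case: eqP => // ->; rewrite (negbTE is2).
  have mB' j : measurable (B' j) by rewrite /B'; case: ifP.
  have := IH (i :: s2) B' us' mB'.
  rewrite big_cons B'i.
  have -> : \prod_(j <- s2) fine (P (X j @^-1` B' j)) =
            \prod_(j <- s2) fine (P (X j @^-1` B j)).
    by apply: eq_big_seq => j /B's2 ->.
  move=> E; transitivity (c%:E * P (X i @^-1` A))%E; first by [].
  rewrite -[P _]fineK; last by apply: fin_num_measure; exact: preimage_measurable.
  rewrite -EFinM /c -mulrA [X in _ * X]mulrC -E.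
  apply: eq_integral => w _; congr EFin; rewrite big_cons B'i /Z mulrCA.
  by congr (_ * (_ * _)); apply: eq_big_seq => j /B's2 ->.
transitivity (\int[nu]_x (f i x)%:E)%E.
  rewrite (@ge0_integral_density _ _ _ _ _ _ (@measurable_funP _ _ _ _ _ (X i)) P nu Z mZ Z0 nuE)//.
  - by apply: eq_integral => w _; rewrite -EFinM /Z big_cons mulrA.
  - exact/measurable_EFinP.
  - by move=> y; rewrite lee_fin.
rewrite /nu ge0_integral_mscale//; last first.
- by move=> x _; rewrite lee_fin.
- exact/measurable_EFinP.
rewrite ge0_integral_distribution//.
- by rewrite fm -EFinM big_cons /c/= mulrC mulrA.
- exact/measurable_EFinP.
- by move=> x; rewrite lee_fin.
Qed.

Lemma independent_integral_prod (s : seq I) (f : I -> R -> R) (m : I -> R) :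
  uniq s ->
  (forall i, measurable_fun setT (f i)) -> (forall i x, 0 <= f i x) ->
  (forall i, \int[P]_w (f i (X i w))%:E = (m i)%:E)%E ->
  (\int[P]_w (\prod_(i <- s) f i (X i w))%:E = (\prod_(i <- s) m i)%:E)%E.
Proof.
move=> us mf f0 fm.
have := @independent_integral_prod_indic s [::] f (fun=> setT) m.
rewrite cats0 => /(_ us mf f0 (fun=> measurableT) fm).
rewrite big_nil mulr1 => <-.
by apply: eq_integral => w _; rewrite big_nil mulr1.
Qed.
End independence.

Section gaussian_mgf.
Context (R : realType).
Local Notation leb := (@lebesgue_measure R).

(** Completing the square: tilting the standard normal density by exp(a x) gives exp(a^2 / 2) times
    the normal density of mean [a], which has total mass 1. *)
Lemma standard_normal_mgf (nu : {measure set R -> \bar R}) (a : R) :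
  (forall A, measurable A -> nu A = normal_prob 0 1 A) ->
  (\int[nu]_x (expR (a * x))%:E = (expR (a ^+ 2 / 2))%:E)%E.
Proof.
move=> nuE.
have mexp : measurable_fun setT (fun x : R => expR (a * x)).
  by apply: measurableT_comp => //; apply: measurable_funM.
have pdfE (x : R) : expR (a * x) * normal_pdf 0 1 x =
    expR (a ^+ 2 / 2) * normal_pdf a 1 x.
  rewrite !normal_pdfE ?oner_eq0// /= /normal_fun mulrCA [RHS]mulrCA.
  congr (_ * _); rewrite -!expRD; congr expR; rewrite subr0 expr1n.
  by field.
have D := fun phi mphi => @ge0_integral_density _ _ (measurableTypeR R) _ R phi mphi leb nu.
rewrite (D id _ (normal_pdf 0 1)) //.
- under eq_integral do rewrite -EFinM pdfE EFinM.
  rewrite ge0_integralZl_EFin ?expR_ge0//.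
  + by rewrite integral_normal_pdf mule1.
  + by move=> x _; rewrite lee_fin normal_pdf_ge0.
  + by apply/measurable_EFinP; exact: measurable_normal_pdf.
- exact: measurable_normal_pdf.
- by move=> x; rewrite normal_pdf_ge0.
- move=> A mA; rewrite nuE//; transitivity (\int[leb]_(x in A) (normal_pdf 0 1 x)%:E)%E => //.
  rewrite [LHS]integral_mkcond; congr (integral _ _ _); apply/funext => x.
  rewrite patchE indicE; case: ifPn => xA; first by rewrite mul1r.
  by rewrite mul0r.
- exact/measurable_EFinP.
Qed.

End gaussian_mgf.

Section mgf_linear.
Context d (T : measurableType d) (R : realType) (P : probability T R).
Variables (n : nat) (g : 'I_n -> nat -> {RV P >-> R}).
Hypothesis hg : gaussian_matrix g.

Lemma gaussian_entry_mgf i j (a : R) :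
  (\int[P]_w (expR (a * g i j w))%:E = (expR (a ^+ 2 / 2))%:E)%E.
Proof.
have mexp : measurable_fun setT (fun x : R => expR (a * x)).
  by apply: measurableT_comp => //; apply: measurable_funM.
rewrite -(standard_normal_mgf a (hg.1 i j)).
rewrite (ge0_integral_distribution (g i j) (f := fun x => (expR (a * x))%:E)) //.
exact/measurable_EFinP.
Qed.

Lemma gaussian_linear_mgf (s : seq ('I_n * nat)) (a : 'I_n * nat -> R) :
  uniq s ->
  (\int[P]_w (expR (\sum_(e <- s) a e * g e.1 e.2 w))%:E =
   (expR ((\sum_(e <- s) a e ^+ 2) / 2))%:E)%E.
Proof.
move=> us.
under eq_integral do rewrite expR_sum.
rewrite (independent_integral_prod hg.2 us (f := fun e x => expR (a e * x))
  (m := fun e => expR (a e ^+ 2 / 2)))//.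
- by rewrite -expR_sum mulr_suml.
- move=> e; apply: measurableT_comp => //; exact: measurable_funM.
- by move=> e; exact: gaussian_entry_mgf.
Qed.

End mgf_linear.

(** * Elementary inequalities and lattice nets *)

Section cosh_bounds.
Variable R : realType.
Implicit Types y k : R.

(* A combination of exponentials of multiples of y that dominates exp(-2 y^2):
   products of such functions of Gaussian linear forms are integrated by the
   moment generating function alone. *)
Definition coshpoly k y : R :=
  let W := (expR y + expR (- y)) / 2 - 1 in 1 - k * W + k ^+ 2 * W ^+ 2.

(** Let W = cosh y - 1 and a = k W. If y^2 <= 1/2, then a <= W <= 2 y^2 because cosh y <= 1 / (1 -
    y^2), and exp(-a) <= 1 / (1 + a) <= 1 - a + a^2. Otherwise exp(-2 y^2) <= 1/e <= 1/2, while 1 -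
    a + a^2 never falls below 3/4. *)
Lemma expR_le_coshpoly k y : 0 <= k <= 1 -> expR (- 2 * y ^+ 2) <= coshpoly k y.
Proof.
move=> /andP[k0 k1]; rewrite /coshpoly; set W := _ - 1.
have e1 : expR y * expR (- y) = 1 by rewrite -expRD subrr expR0.
have p1 := expR_gt0 y; have p2 := expR_gt0 (- y).
have W0 : 0 <= W by have := expR_ge1Dx y; have := expR_ge1Dx (- y); rewrite /W; lra.
have [y2|y2] := leP (y ^+ 2) (2^-1).
- have W2 : W <= 2 * y ^+ 2.
    have g1 := expR_ge1Dx y; have g2 := expR_ge1Dx (- y).
    have ym1 : -1 < y < 1 by apply/andP; split; nra.
    have h1 : expR y * (1 - y) <= 1 by nra.
    have h2 : expR (- y) * (1 + y) <= 1 by nra.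
    have h : (expR y + expR (- y)) * (1 - y ^+ 2) <= 2 by nra.
    by rewrite /W; nra.
  have a0 : 0 <= k * W by nra.
  have : expR (- (k * W)) * (1 + k * W) <= 1.
    have := expR_ge1Dx (k * W).
    have : expR (k * W) * expR (- (k * W)) = 1 by rewrite -expRD subrr expR0.
    by have := expR_gt0 (- (k * W)); nra.
  have : expR (- 2 * y ^+ 2) <= expR (- (k * W)).
    by rewrite ler_expR; nra.
  have := expR_gt0 (- (k * W)).
  have -> : k ^+ 2 * W ^+ 2 = (k * W) ^+ 2 by ring.
  move: (k * W) a0 => a a0 q1 q2 q3; nra.
- have : expR (- 2 * y ^+ 2) <= expR (- 1) by rewrite ler_expR; nra.
  have : expR 1 * expR (- 1) = 1 :> R by rewrite -expRD subrr expR0.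
  have := expR_ge1Dx (1 : R); have := expR_gt0 (- 1 : R).
  have -> : k ^+ 2 * W ^+ 2 = (k * W) ^+ 2 by ring.
  move: (k * W) (expR (-1)) (expR 1) => a u v q1 q2 q3 q4.
  have : u <= 1 / 2 by nra.
  have := sqr_ge0 (a - 1 / 2); rewrite sqrrB; lra.
Qed.

Definition coshpoly_coef k (i : 'I_5) : R :=
  [:: k ^+ 2 / 4; - (k / 2 + k ^+ 2); 1 + k + 3 / 2 * k ^+ 2;
      - (k / 2 + k ^+ 2); k ^+ 2 / 4]`_i.

Lemma coshpolyE k y :
  coshpoly k y = \sum_(i < 5) coshpoly_coef k i * expR ((i%:R - 2) * y).
Proof.
rewrite 5!big_ord_recl big_ord0 /coshpoly_coef /= /bump /=.
have e1 : expR y * expR (- y) = 1 by rewrite -expRD subrr expR0.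
have -> : (0 - 2) * y = - y + - y by ring.
have -> : (1 - 2) * y = - y by ring.
have -> : ((1 + 1)%N%:R - 2) * y = 0 by ring.
have -> : ((1 + (1 + 1))%N%:R - 2) * y = y by ring.
have -> : ((1 + (1 + (1 + 1)))%N%:R - 2) * y = y + y by ring.
rewrite !expRD expR0 /coshpoly.
have -> : ((expR y + expR (- y)) / 2 - 1) ^+ 2 =
  (expR y ^+ 2 + expR (- y) ^+ 2) / 4 + (expR y * expR (- y)) / 2
    - (expR y + expR (- y)) + 1 by field.
by rewrite e1; field.
Qed.

(** The sum is the mean of [coshpoly k] at a standard Gaussian, 1 - k E W + k^2 E W^2, where E W =
    [m] and E W^2 <= [S] (a negative term - 2 exp(1/2) is dropped). The choice of [k] gives k S <= m
    / 2, so the mean is at most 1 - k m / 2. Nonnegativity is recorded because the bound is later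
    raised to the power q. *)
Lemma coshpoly_gaussian_mean : exists k del : R, [/\ 0 <= k <= 1, 0 < del &
  0 <= \sum_(i < 5) coshpoly_coef k i * expR ((i%:R - 2) ^+ 2 / 2)
    <= expR (- del)].
Proof.
pose m : R := expR (1 / 2) - 1; pose S : R := 3 / 2 + expR 2 / 2.
have m0 : 0 < m by have := expR_ge1Dx (1 / 2 : R); rewrite /m; lra.
have S0 : 0 < S by have := expR_gt0 (2 : R); rewrite /S; lra.
pose k := m / (2 * S + m).
have d0 : 0 < 2 * S + m by lra.
have kE : k * (2 * S + m) = m by rewrite /k divfK// gt_eqF.
have k0 : 0 < k by rewrite divr_gt0.
exists k, (k * m / 2); split; [by apply/andP; split; nra|by nra|].
rewrite 5!big_ord_recl big_ord0 /coshpoly_coef /= /bump /=.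
have -> : (0 - 2) ^+ 2 / 2 = 2 :> R by field.
have -> : (1 - 2) ^+ 2 / 2 = 1 / 2 :> R by field.
have -> : ((1 + 1)%N%:R - 2) ^+ 2 / 2 = 0 :> R by field.
have -> : ((1 + (1 + 1))%N%:R - 2) ^+ 2 / 2 = 1 / 2 :> R by field.
have -> : ((1 + (1 + (1 + 1)))%N%:R - 2) ^+ 2 / 2 = 2 :> R by field.
rewrite expR0.
have -> : expR (1 / 2) = m + 1 :> R by rewrite /m; ring.
have E2 : expR 2 = 2 * S - 3 :> R by rewrite /S; field.
apply/andP; split; last first.
  by rewrite E2; apply: le_trans (expR_ge1Dx _); nra.
have e2m : expR 2 = (m + 1) ^+ 4 :> R.
  have -> : m + 1 = expR (1 / 2) by rewrite /m; ring.
  by rewrite -expRM_natl; congr expR; field.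
have b1 : 1 + 4 * m <= (m + 1) ^+ 4 by nra.
have mS : m ^+ 2 <= 2 * S by nra.
have km : k * m <= 1 by nra.
rewrite e2m; nra.
Qed.

End cosh_bounds.

Section sums_of_squares.
Variable R : realType.

Lemma sum_sqr_ge0 (I : finType) (u : I -> R) : 0 <= \sum_i u i ^+ 2.
Proof. by apply: sumr_ge0 => i _; rewrite sqr_ge0. Qed.

Lemma sum_sqr_eq0 (I : finType) (u : I -> R) :
  \sum_i u i ^+ 2 = 0 -> forall i, u i = 0.
Proof.
move=> /eqP; rewrite psumr_eq0; last by move=> i _; rewrite sqr_ge0.
by move=> /allP u0 i; apply/eqP; rewrite -sqrf_eq0; apply: u0; rewrite mem_index_enum.
Qed.

Lemma cauchy_schwarz (I : Type) (r : seq I) (a b : I -> R) :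
  (\sum_(i <- r) a i * b i) ^+ 2 <=
  (\sum_(i <- r) a i ^+ 2) * (\sum_(i <- r) b i ^+ 2).
Proof.
elim: r => [|i r IH]; first by rewrite !big_nil expr0n mul0r.
rewrite !big_cons; move: IH.
have : 0 <= \sum_(i <- r) a i ^+ 2 by apply: sumr_ge0 => j _; rewrite sqr_ge0.
have : 0 <= \sum_(i <- r) b i ^+ 2 by apply: sumr_ge0 => j _; rewrite sqr_ge0.
move: (\sum_(i <- r) a i * b i) (\sum_(i <- r) a i ^+ 2) (\sum_(i <- r) b i ^+ 2).
move=> S A B; move: (a i) (b i) => x y B0 A0 h.
suff : 2 * (x * y * S) <= x ^+ 2 * B + A * y ^+ 2 by nra.
have h1 : ((x * y) * S) ^+ 2 <= (x ^+ 2 * B) * (A * y ^+ 2).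
  have -> : ((x * y) * S) ^+ 2 = (x * y) ^+ 2 * S ^+ 2 by ring.
  have -> : (x ^+ 2 * B) * (A * y ^+ 2) = (x * y) ^+ 2 * (A * B) by ring.
  by rewrite ler_wpM2l// sqr_ge0.
have p0 : 0 <= x ^+ 2 * B by rewrite mulr_ge0// sqr_ge0.
have q0 : 0 <= A * y ^+ 2 by rewrite mulr_ge0// sqr_ge0.
move: (x * y * S) (x ^+ 2 * B) (A * y ^+ 2) h1 p0 q0 => s p q h1 p0 q0.
apply: contraTT h1; rewrite -!ltNge => h2.
have : (p + q) ^+ 2 < (2 * s) ^+ 2 by nra.
have := sqr_ge0 (p - q); nra.
Qed.

End sums_of_squares.

Section lattice_net.
Variable R : realType.

(** Integer vectors of l1 norm at most [A], coded by signs and absolute values. A zero coordinate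
    has two codes, which is harmless in an upper bound for the cardinality. *)
Definition lattice_net (p A : nat) : {set {ffun 'I_p -> bool * 'I_A.+1}} :=
  [set z : {ffun 'I_p -> bool * 'I_A.+1} | (\sum_i (z i).2 <= A)%N]%SET.

Definition lattice_point (a p A : nat) (z : {ffun 'I_p -> bool * 'I_A.+1})
  (i : 'I_p) : R := (-1) ^+ (z i).1 * ((z i).2)%:R / a%:R.

Lemma geometric_half_le2 (n : nat) : \sum_(i < n) (2^-1 : R) ^+ i <= 2.
Proof.
suff -> : \sum_(i < n) (2^-1 : R) ^+ i = 2 - 2 * 2^-1 ^+ n.
  by rewrite gerBl mulr_ge0// exprn_ge0.
elim: n => [|n IH]; first by rewrite big_ord0 expr0; ring.
by rewrite big_ord_recr /= IH exprS; field.
Qed.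

(** Each net point z has weight 2^A prod_i 2^-|z_i| >= 1. Summed over all codes, the weights factor
    over the coordinates, and one coordinate contributes at most 4: two signs times a geometric
    series. *)
Lemma card_lattice_net (p A : nat) :
  #|lattice_net p A|%:R <= (2 ^+ A * 4 ^+ p : R).
Proof.
rewrite -sum1_card natr_sum.
apply: (@le_trans _ _ (\sum_(z in lattice_net p A)
    2 ^+ A * \prod_(i < p) 2^-1 ^+ (z i).2)).
  apply: ler_sum => z; rewrite inE => zA.
  rewrite prodrXr exprVn ler_pdivlMr ?exprn_gt0// mul1r.
  by rewrite ler_weXn2l// ler1n.
rewrite -mulr_sumr ler_wpM2l ?exprn_ge0//.
apply: (@le_trans _ _ (\sum_(z : {ffun 'I_p -> bool * 'I_A.+1})
    \prod_(i < p) 2^-1 ^+ (z i).2)).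
  rewrite big_mkcond; apply: ler_sum => z _; case: ifP => // _.
  by apply: prodr_ge0 => i _; rewrite exprn_ge0.
rewrite -(bigA_distr_bigA (fun (i : 'I_p) (x : bool * 'I_A.+1) => (2^-1 : R) ^+ x.2)).
rewrite prodr_const card_ord.
rewrite lerXn2r ?nnegrE//.
  by apply: sumr_ge0 => j _; rewrite exprn_ge0.
rewrite (_ : \sum_j _ = \sum_(b : bool) \sum_(j < A.+1) 2^-1 ^+ j).
  by rewrite big_bool/=; have := geometric_half_le2 A.+1; lra.
by rewrite pair_bigA.
Qed.

(** The coordinates of a u are rounded towards zero: each error is at most 1 / a, the norm does not
    grow, and a |u_i| <= a (1 + u_i^2) / 2 bounds the l1 norm. *)
Lemma lattice_net_approx (a p A : nat) (r : R) (u : 'I_p -> R) :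
  (0 < a)%N -> a%:R * (p%:R + r) / 2 <= A%:R -> \sum_i u i ^+ 2 <= r ->
  exists2 z, z \in lattice_net p A &
    \sum_i (u i - lattice_point a z i) ^+ 2 <= p%:R / a%:R ^+ 2 /\
    \sum_i lattice_point a z i ^+ 2 <= \sum_i u i ^+ 2.
Proof.
move=> a0 hA ur.
have ap : 0 < a%:R :> R by rewrite ltr0n.
pose m i := Num.truncn (a%:R * `|u i|).
have mP i : (m i)%:R <= a%:R * `|u i| < (m i).+1%:R.
  by apply: truncn_itv; rewrite mulr_ge0.
have sm : (\sum_i m i <= A)%N.
  rewrite -(ler_nat R) natr_sum; apply: le_trans hA.
  apply: (@le_trans _ _ (\sum_(i < p) a%:R * (1 + u i ^+ 2) / 2)).
    apply: ler_sum => i _; have /andP[+ _] := mP i => /le_trans; apply.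
    rewrite -mulrA ler_wpM2l ?ler0n//.
    by have := sqr_ge0 (`|u i| - 1); rewrite sqrrB real_normK ?num_real//; lra.
  rewrite -mulr_suml -mulr_sumr big_split/= sumr_const card_ord.
  rewrite ler_wpM2r// ler_wpM2l ?ler0n//; lra.
have mA i : (m i < A.+1)%N.
  by rewrite ltnS (leq_trans _ sm)// (bigD1 i)//= leq_addr.
exists [ffun i => (u i < 0, Ordinal (mA i))].
  by rewrite inE; under eq_bigr do rewrite ffunE.
have ptE i : lattice_point a [ffun i => (u i < 0, Ordinal (mA i))] i =
    (-1) ^+ (u i < 0)%R * ((m i)%:R / a%:R).
  by rewrite /lattice_point ffunE /= mulrA.
have hm i : (m i)%:R / a%:R <= `|u i| by rewrite ler_pdivrMr// mulrC; case/andP: (mP i).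
split.
- apply: (@le_trans _ _ (\sum_(i < p) a%:R ^- 2)).
    apply: ler_sum => i _; rewrite ptE {1}(numEsign (u i)) -mulrBr exprMn sqrr_sign mul1r.
    rewrite -exprVn ler_sqr ?nnegrE ?invr_ge0 ?subr_ge0//.
    rewrite lerBlDr -[X in X + _]mul1r -mulrDl ler_pdivlMr// addrC natr1 mulrC ltW//.
    by case/andP: (mP i).
  by rewrite sumr_const card_ord -[X in X <= _]mulr_natl.
- apply: ler_sum => i _; rewrite ptE exprMn sqrr_sign mul1r.
  rewrite -[u i ^+ 2]real_normK ?num_real// ler_sqr ?nnegrE//.
Qed.

End lattice_net.

(** * Extreme singular values of a Gaussian block *)

Section measurable_events.
Context d (T : measurableType d) (R : realType) (P : probability T R).

Lemma measurable_set_ge (f : T -> R) t :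
  measurable_fun setT f -> measurable [set w | t <= f w].
Proof.
move=> mf; have -> : [set w | t <= f w] = f @^-1` `[t, +oo[.
  by apply/seteqP; split => w /=; rewrite in_itv/= andbT.
by rewrite -[_ @^-1` _]setTI; apply: mf.
Qed.

Lemma measurable_set_le (f : T -> R) t :
  measurable_fun setT f -> measurable [set w | f w <= t].
Proof.
move=> mf; have -> : [set w | f w <= t] = f @^-1` `]-oo, t].
  by apply/seteqP; split => w /=; rewrite in_itv/=.
by rewrite -[_ @^-1` _]setTI; apply: mf.
Qed.

Lemma prob_le_integral (A : set T) (f : T -> R) :
  measurable A -> measurable_fun setT f -> (forall w, 0 <= f w) ->
  (forall w, A w -> 1 <= f w) -> (P A <= \int[P]_w (f w)%:E)%E.
Proof.
move=> mA mf f0 Af; rewrite -[A]setIT -integral_indic//.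
apply: ge0_le_integral => //.
- by apply/measurable_EFinP.
- exact/measurable_EFinP.
- move=> w _; rewrite lee_fin indicE; case: (boolP (w \in A)) => // /[1!inE].
  by move/Af.
Qed.

Lemma prob_bigsetU_le (I : finType) (S : {pred I}) (B : I -> set T) (c : R) :
  (forall i, i \in S -> measurable (B i)) ->
  (forall i, i \in S -> (P (B i) <= c%:E)%E) ->
  (P (\big[setU/set0]_(i in S) B i) <= (#|S|%:R * c)%:E)%E.
Proof.
move=> mB Bc.
suff [_ +] : measurable (\big[setU/set0]_(i in S) B i) /\
    (P (\big[setU/set0]_(i in S) B i) <= \sum_(i in S) c%:E)%E.
  by rewrite sumEFin sumr_const mulr_natl.
elim/big_rec2 : _ => [|i y x iS [mx xy]]; first by split=> //; rewrite measure0.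
split; first by apply: measurableU => //; exact: mB.
apply: le_trans (leeD (Bc _ iS) xy).
by apply: measureU2 => //; exact: mB.
Qed.

End measurable_events.

Lemma measurable_coshpoly (R : realType) (k : R) : measurable_fun setT (coshpoly k).
Proof.
have m1 : measurable_fun setT (fun y : R => expR y + expR (- y)).
  by apply: measurable_funD => //; apply: measurableT_comp.
have m2 : measurable_fun setT (fun y : R => (expR y + expR (- y)) / 2 - 1).
  by apply: measurable_funB => //; apply: measurable_funM.
apply: measurable_funD.
  by apply: measurable_funB => //; apply: measurable_funM.
by apply: measurable_funM => //; apply: measurable_funX.
Qed.

Section gaussian_block.
Context d (T : measurableType d) (R : realType) (P : probability T R).
Variables (p q : nat) (X : 'I_p -> 'I_q -> T -> R).
Hypothesis mX : forall i j, measurable_fun setT (X i j).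
Hypothesis mgfX : forall a : 'I_p -> 'I_q -> R,
  (\int[P]_w (expR (\sum_i \sum_j a i j * X i j w))%:E =
   (expR ((\sum_i \sum_j a i j ^+ 2) / 2))%:E)%E.

(** [X] is a p x q block A, and these are the coordinates of A^T u. The Gaussian law enters only
    through [mgfX], which is available for blocks of columns and for transposed blocks alike. *)
Definition colform (u : 'I_p -> R) (j : 'I_q) (w : T) : R :=
  \sum_i u i * X i j w.

Definition bilform (u : 'I_p -> R) (v : 'I_q -> R) (w : T) : R :=
  \sum_j colform u j w * v j.

Lemma measurable_colform u j : measurable_fun setT (colform u j).
Proof.
by apply: measurable_sum => i; apply: measurable_funM.
Qed.

Lemma measurable_bilform u v : measurable_fun setT (bilform u v).
Proof.
apply: measurable_sum => j; apply: measurable_funM => //.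
exact: measurable_colform.
Qed.

Lemma measurable_sum_colform u :
  measurable_fun setT (fun w => \sum_j colform u j w ^+ 2).
Proof.
apply: measurable_sum => j; apply: measurable_funX; exact: measurable_colform.
Qed.

Lemma mgf_bilform u v :
  (\int[P]_w (expR (bilform u v w))%:E =
   (expR ((\sum_i u i ^+ 2) * (\sum_j v j ^+ 2) / 2))%:E)%E.
Proof.
transitivity (\int[P]_w (expR (\sum_i \sum_j (u i * v j) * X i j w))%:E)%E.
  apply: eq_integral => w _; congr (expR _)%:E.
  rewrite exchange_big; apply: eq_bigr => j _; rewrite /colform mulr_suml.
  by apply: eq_bigr => i _; rewrite mulrAC.
rewrite mgfX; have -> // : \sum_i \sum_j (u i * v j) ^+ 2 =
    (\sum_i u i ^+ 2) * (\sum_j v j ^+ 2).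
rewrite mulr_suml; apply: eq_bigr => i _; rewrite mulr_sumr.
by apply: eq_bigr => j _; rewrite exprMn.
Qed.

Lemma chernoff_bilform u v (s t : R) :
  (P [set w | (t <= s * bilform u v w)%R] <=
   (expR (s ^+ 2 * ((\sum_i u i ^+ 2) * (\sum_j v j ^+ 2)) / 2 - t))%:E)%E.
Proof.
have mb := measurable_bilform u v.
have msb : measurable_fun setT (fun w => s * bilform u v w).
  exact: measurable_funM.
apply: (le_trans (@prob_le_integral _ _ _ P _
    (fun w => expR (- t) * expR (bilform (fun i => s * u i) v w)) _ _ _ _)).
- exact: measurable_set_ge.
- apply: measurable_funM => //; apply: measurableT_comp => //.
  exact: measurable_bilform.
- by move=> w; rewrite mulr_ge0 ?expR_ge0.
- move=> w /= tw; rewrite -expRD.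
  have -> : bilform (fun i => s * u i) v w = s * bilform u v w.
    rewrite /bilform mulr_sumr; apply: eq_bigr => j _; rewrite mulrA; congr (_ * _).
    by rewrite /colform mulr_sumr; apply: eq_bigr => i _; rewrite mulrA.
  by apply: le_trans (expR_ge1Dx _); lra.
under eq_integral do rewrite EFinM.
rewrite ge0_integralZl_EFin ?expR_ge0//; last first.
  apply/measurable_EFinP; apply: measurableT_comp => //.
  exact: measurable_bilform.
rewrite mgf_bilform -EFinM -expRD lee_fin ler_expR.
under eq_bigr do rewrite exprMn.
by rewrite -mulr_sumr; lra.
Qed.

(** The exponential splits into one factor per column, each dominated by [coshpoly]. Expanding the
    product over all choices [f] of exponents gives exponentials of bilinear forms, whose means
    factor over the columns; resumming yields the q-th power of the Gaussian mean of [coshpoly]. *)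
Lemma integral_exp_colform (k del : R) u : 0 <= k <= 1 ->
  0 <= \sum_(i < 5) coshpoly_coef k i * expR ((i%:R - 2) ^+ 2 / 2)
    <= expR (- del) ->
  \sum_i u i ^+ 2 = 1 ->
  (\int[P]_w (expR (- 2 * \sum_j colform u j w ^+ 2))%:E <=
   (expR (- del * q%:R))%:E)%E.
Proof.
move=> k01 /andP[hk0 hk] u1.
pose c := coshpoly_coef k; pose s (i : 'I_5) : R := i%:R - 2.
apply: (@le_trans _ _ (\int[P]_w (\prod_j coshpoly k (colform u j w))%:E)%E).
  apply: ge0_le_integral => //.
  - apply/measurable_EFinP; apply: measurableT_comp => //.
    by apply: measurable_funM => //; exact: measurable_sum_colform.
  - apply/measurable_EFinP; apply: measurable_prod => j _.
    by apply: measurableT_comp (measurable_colform u j); exact: measurable_coshpoly.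
  - move=> w _; rewrite lee_fin mulr_sumr expR_sum; apply: ler_prod => j _.
    by rewrite expR_ge0 expR_le_coshpoly.
pose F (f : {ffun 'I_q -> 'I_5}) w : R := (\prod_j c (f j)) * expR (bilform u (fun j => s (f j)) w).
have FE w : (\prod_j coshpoly k (colform u j w))%:E = (\sum_f (F f w)%:E)%E.
  rewrite sumEFin; congr EFin.
  under eq_bigr do rewrite coshpolyE.
  rewrite (bigA_distr_bigA (fun j i => coshpoly_coef k i * expR ((i%:R - 2) * colform u j w))).
  apply: eq_bigr => f _; rewrite big_split/= -expR_sum; congr (_ * expR _).
  by apply: eq_bigr => j _; rewrite mulrC.
under eq_integral do rewrite FE.
(* The coefficients of [coshpoly] have both signs, so the integral of the sum is split by
   integrability rather than by nonnegativity. *)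
have iE f : P.-integrable setT (fun w => (expR (bilform u (fun j => s (f j)) w))%:E).
  apply/integrableP; split.
    by apply/measurable_EFinP; apply: measurableT_comp => //; exact: measurable_bilform.
  under eq_integral do rewrite gee0_abs ?lee_fin ?expR_ge0//.
  by rewrite mgf_bilform ltry.
rewrite integral_sum//; last first.
  move=> f; under eq_fun do rewrite EFinM.
  exact: integrableZl.
have fE f : (\int[P]_w (F f w)%:E = (\prod_j (c (f j) * expR (s (f j) ^+ 2 / 2)))%:E)%E.
  under eq_integral do rewrite EFinM.
  rewrite integralZl// mgf_bilform -EFinM u1 mul1r big_split/= -expR_sum.
  by rewrite mulr_suml.
under eq_bigr do rewrite fE.
rewrite sumEFin -(bigA_distr_bigA (fun j i => c i * expR (s i ^+ 2 / 2))).
rewrite lee_fin prodr_const card_ord mulrC expRM_natl.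
by rewrite lerXn2r ?nnegrE ?expR_ge0.
Qed.
End gaussian_block.

Section block_bounds.
Context d (T : measurableType d) (R : realType) (P : probability T R).
Variables (p q : nat) (X : 'I_p -> 'I_q -> T -> R).
Hypothesis mX : forall i j, measurable_fun setT (X i j).
Hypothesis mgfX : forall a : 'I_p -> 'I_q -> R,
  (\int[P]_w (expR (\sum_i \sum_j a i j * X i j w))%:E =
   (expR ((\sum_i \sum_j a i j ^+ 2) / 2))%:E)%E.

Local Notation col := (colform X).
Local Notation bil := (bilform X).

Lemma colformZ c u j w : col (fun i => c * u i) j w = c * col u j w.
Proof.
by rewrite /colform mulr_sumr; apply: eq_bigr => i _; rewrite mulrA.
Qed.

Lemma colformB u v j w : col (fun i => u i - v i) j w = col u j w - col v j w.
Proof.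
by rewrite /colform -sumrB; apply: eq_bigr => i _; rewrite mulrBl.
Qed.

Lemma sum_colformZ c u w :
  \sum_j col (fun i => c * u i) j w ^+ 2 = c ^+ 2 * \sum_j col u j w ^+ 2.
Proof. by rewrite mulr_sumr; apply: eq_bigr => j _; rewrite colformZ exprMn. Qed.

Lemma bilformZl c u v w : bil (fun i => c * u i) v w = c * bil u v w.
Proof.
by rewrite /bilform mulr_sumr; apply: eq_bigr => j _; rewrite colformZ mulrA.
Qed.

Lemma bilformZr c u v w : bil u (fun j => c * v j) w = c * bil u v w.
Proof.
by rewrite /bilform mulr_sumr; apply: eq_bigr => j _; rewrite mulrCA.
Qed.

Lemma bilformBl u u' v w : bil (fun i => u i - u' i) v w = bil u v w - bil u' v w.
Proof.
by rewrite /bilform -sumrB; apply: eq_bigr => j _; rewrite colformB mulrBl.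
Qed.

Lemma bilformBr u v v' w : bil u (fun j => v j - v' j) w = bil u v w - bil u v' w.
Proof. by rewrite /bilform -sumrB; apply: eq_bigr => j _; rewrite mulrBr. Qed.

(** Only finiteness matters: it makes the supremum in the self-bounding argument of [bilform_le] a
    real number. *)
Lemma bilform_bounded (r : R) w : exists B : R, forall u v,
  \sum_i u i ^+ 2 <= r -> \sum_j v j ^+ 2 <= r -> bil u v w <= B.
Proof.
exists (\sum_j \sum_i r * `|X i j w|) => u v ur vr.
apply: ler_sum => j _; rewrite /colform mulr_suml; apply: ler_sum => i _.
have ui : u i ^+ 2 <= r.
  by apply: le_trans ur; rewrite (bigD1 i)//= lerDl sumr_ge0// => k _; rewrite sqr_ge0.
have vj : v j ^+ 2 <= r.
  by apply: le_trans vr; rewrite (bigD1 j)//= lerDl sumr_ge0// => k _; rewrite sqr_ge0.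
rewrite mulrAC; apply: le_trans (ler_norm _) _; rewrite normrM ler_wpM2r//.
rewrite ler_norml; apply/andP; split.
  by have := sqr_ge0 (u i + v j); rewrite sqrrD; lra.
by have := sqr_ge0 (u i - v j); rewrite sqrrB; lra.
Qed.

Lemma le_expR_pow2 (n : nat) (x : R) : n%:R <= x -> 2 ^+ n <= expR x.
Proof.
move=> nx; apply: (@le_trans _ _ (expR n%:R)); last by rewrite ler_expR.
rewrite -[n%:R]mulr1 expRM_natl lerXn2r ?nnegrE ?expR_ge0//.
by have := expR_ge1Dx (1 : R); lra.
Qed.

(** Mesh 1/4 leaves errors of at most a quarter of the radius sqrt q when p <= q, and the l1 radius
    4 q is a (q + r) / 2 for a = 4 and r = q. *)
Definition upper_net :
    {set {ffun 'I_p -> bool * 'I_(4 * q).+1} * {ffun 'I_q -> bool * 'I_(4 * q).+1}} :=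
  [set zz in finset.setX (lattice_net p (4 * q)) (lattice_net q (4 * q)) |
     (\sum_i lattice_point R 4 zz.1 i ^+ 2 <= q%:R) &&
     (\sum_j lattice_point R 4 zz.2 j ^+ 2 <= q%:R)]%SET.

(* The threshold 14 q leaves exp(- 13 q) for each of the at most 2 ^ (12 q)
   pairs of net points. *)
Definition bad_upper : set T :=
  \big[setU/set0]_(zz in upper_net)
    [set w | 14 * q%:R <= (Num.sqrt q%:R)^-1 *
       bil (lattice_point R 4 zz.1) (lattice_point R 4 zz.2) w].

Lemma measurable_bad_upper : measurable bad_upper.
Proof.
apply: bigsetU_measurable => zz _; apply: measurable_set_ge.
by apply: measurable_funM => //; exact: measurable_bilform.
Qed.

Lemma card_upper_net : (p <= q)%N -> #|upper_net|%:R <= (2 ^+ (12 * q) : R).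
Proof.
move=> pq; have h : (#|upper_net| <= #|lattice_net p (4 * q)| * #|lattice_net q (4 * q)|)%N.
  by rewrite -cardsX; apply: subset_leq_card; apply/fintype.subsetP => zz; rewrite inE => /andP[].
apply: (@le_trans _ _ (#|lattice_net p (4 * q)|%:R * #|lattice_net q (4 * q)|%:R)).
  by rewrite -natrM ler_nat.
have -> : 2 ^+ (12 * q) = (2 ^+ (4 * q) * 4 ^+ q) * (2 ^+ (4 * q) * 4 ^+ q) :> R.
  have -> : 4 = 2 ^+ 2 :> R by rewrite expr2; ring.
  by rewrite -exprM -!exprD; congr (_ ^+ _); lia.
apply: ler_pM => //; last exact: card_lattice_net.
apply: le_trans (card_lattice_net _ _ _) _.
by rewrite ler_pM2l ?exprn_gt0// ler_weXn2l// ler1n.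
Qed.

Lemma prob_bad_upper : (0 < q)%N -> (p <= q)%N ->
  (P bad_upper <= (expR (- q%:R))%:E)%E.
Proof.
move=> q0 pq; have qR : 0 < q%:R :> R by rewrite ltr0n.
apply: le_trans (prob_bigsetU_le (c := expR (- (13 * q%:R))) _ _) _.
- move=> zz _; apply: measurable_set_ge.
  by apply: measurable_funM => //; exact: measurable_bilform.
- move=> zz; rewrite inE => /and3P[_ uq vq].
  apply: le_trans (chernoff_bilform mX mgfX _ _ _ _) _; rewrite lee_fin ler_expR.
  rewrite exprVn sqr_sqrtr ?ler0n//.
  have : (\sum_i lattice_point R 4 zz.1 i ^+ 2) *
         (\sum_j lattice_point R 4 zz.2 j ^+ 2) <= q%:R * q%:R.
    by apply: ler_pM => //; exact: sum_sqr_ge0.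
  move: (_ * _) => x; rewrite -(@ler_pM2l _ q%:R^-1) ?invr_gt0// mulKf ?gt_eqF//.
  by lra.
rewrite lee_fin; apply: (@le_trans _ _ (expR (12 * q%:R) * expR (- (13 * q%:R)))).
  rewrite ler_wpM2r ?expR_ge0//; apply: le_trans (card_upper_net pq) _.
  by apply: le_expR_pow2; rewrite natrM.
by rewrite -expRD ler_expR; lra.
Qed.

(** Let s be the supremum of the form over the two balls. With u and v written as net point plus
    error, the form at the net points is at most 14 q sqrt q, and each of the two error terms is at
    most s / 4, since four times an error lies in the ball again. Hence s <= 14 q sqrt q + s / 2. *)
Lemma bilform_le w u v : (0 < q)%N -> (p <= q)%N -> ~ bad_upper w ->
  \sum_i u i ^+ 2 <= q%:R -> \sum_j v j ^+ 2 <= q%:R ->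
  bil u v w <= 28 * q%:R * Num.sqrt q%:R.
Proof.
move=> q0 pq bw; have qR : 0 < q%:R :> R by rewrite ltr0n.
have sq : 0 < Num.sqrt q%:R :> R by rewrite sqrtr_gt0.
pose Th : R := 14 * q%:R * Num.sqrt q%:R.
pose S := [set b | exists u v, [/\ \sum_i u i ^+ 2 <= q%:R,
   \sum_j v j ^+ 2 <= q%:R & b = bil u v w]].
have [B hB] := bilform_bounded q%:R w.
have SB : ubound S B by move=> _ [u' [v' [u'q v'q ->]]]; exact: hB.
have S0 : S !=set0.
  exists (bil (fun=> 0) (fun=> 0) w), (fun=> 0), (fun=> 0).
  by split=> //; rewrite big1 ?ler0n// => i _; rewrite expr0n.
have hS : has_sup S by split => //; exists B.
have le_sup u' v' : \sum_i u' i ^+ 2 <= q%:R -> \sum_j v' j ^+ 2 <= q%:R ->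
    bil u' v' w <= sup S.
  by move=> h1 h2; apply: ub_le_sup; [exists B|exists u', v'].
have main u' v' : \sum_i u' i ^+ 2 <= q%:R -> \sum_j v' j ^+ 2 <= q%:R ->
    bil u' v' w <= Th + sup S / 2.
  move=> uq vq.
  have pq' : p%:R <= q%:R :> R by rewrite ler_nat.
  have pA : 4%:R * (p%:R + q%:R) / 2 <= (4 * q)%:R :> R by rewrite natrM; lra.
  have qA : 4%:R * (q%:R + q%:R) / 2 <= (4 * q)%:R :> R by rewrite natrM; lra.
  have [zu zuN [zu1 zu2]] := @lattice_net_approx R 4 p (4 * q) q%:R u' isT pA uq.
  have [zv zvN [zv1 zv2]] := @lattice_net_approx R 4 q (4 * q) q%:R v' isT qA vq.
  set a := lattice_point R 4 zu in zu1 zu2; set b := lattice_point R 4 zv in zv1 zv2.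
  have h1 : bil a b w <= Th.
    rewrite leNgt; apply/negP => hlt; apply: bw.
    rewrite /bad_upper (bigD1 (zu, zv)) /=; last first.
      rewrite inE finset.in_setX zuN zvN/=; apply/andP; split; first exact: le_trans zu2 uq.
      exact: le_trans zv2 vq.
    by left; rewrite /= ler_pdivlMl// mulrC ltW.
  have h2 : 4 * bil (fun i => u' i - a i) v' w <= sup S.
    rewrite -bilformZl; apply: le_sup => //.
    under eq_bigr do rewrite exprMn; rewrite -mulr_sumr.
    by move: zu1; move: (\sum_i _) => x; lra.
  have h3 : 4 * bil a (fun j => v' j - b j) w <= sup S.
    rewrite -bilformZr; apply: le_sup; first exact: le_trans zu2 uq.
    under eq_bigr do rewrite exprMn; rewrite -mulr_sumr.
    by move: zv1; move: (\sum_i _) => x; lra.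
  by move: h2 h3; rewrite bilformBl bilformBr; lra.
move=> uq vq; apply: le_trans (le_sup _ _ uq vq) _.
have : sup S <= Th + sup S / 2.
  by apply: ge_sup => // _ [u' [v' [u'q v'q ->]]]; exact: main.
by rewrite /Th; lra.
Qed.

(** Duality: |A^T u|^2 is the bilinear form at u and v = A^T u; both vectors are rescaled to norm
    sqrt q. *)
Lemma sum_colform_le w u : (0 < q)%N -> (p <= q)%N -> ~ bad_upper w ->
  \sum_j col u j w ^+ 2 <= 28 ^+ 2 * q%:R * \sum_i u i ^+ 2.
Proof.
move=> q0 pq bw; have qR : 0 < q%:R :> R by rewrite ltr0n.
have sqE : Num.sqrt q%:R ^+ 2 = q%:R :> R by rewrite sqr_sqrtr// ltW.
set Y := \sum_j _; set A := \sum_i _.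
have A0 : 0 <= A by exact: sum_sqr_ge0.
have [Y0|Y0] := leP Y 0; first by apply: le_trans Y0 _; apply: mulr_ge0 A0; apply: mulr_ge0; rewrite ?sqr_ge0 ?ler0n.
have [AE|An] := eqVneq A 0.
  suff : Y = 0 by lra.
  rewrite /Y big1// => j _; rewrite /colform big1 ?expr0n// => i _.
  by rewrite (sum_sqr_eq0 AE) mul0r.
have Ap : 0 < A by rewrite lt_neqAle eq_sym An.
pose a := Num.sqrt (q%:R / A); pose b := Num.sqrt (q%:R / Y).
have aE : a ^+ 2 = q%:R / A by rewrite sqr_sqrtr// divr_ge0// ltW.
have bE : b ^+ 2 = q%:R / Y by rewrite sqr_sqrtr// divr_ge0// ltW.
have := @bilform_le w (fun i => a * u i) (fun j => b * col u j w) q0 pq bw.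
under eq_bigr do rewrite exprMn; rewrite -mulr_sumr -/A aE divfK//.
under eq_bigr do rewrite exprMn; rewrite -mulr_sumr -/Y bE divfK ?gt_eqF//.
rewrite bilformZl bilformZr => /(_ (lexx _) (lexx _)).
have -> : bil u (col u ^~ w) w = Y by apply: eq_bigr => j _; rewrite expr2.
move=> h.
have : (a * (b * Y)) ^+ 2 <= (28 * q%:R * Num.sqrt q%:R) ^+ 2.
  by rewrite lerXn2r ?nnegrE ?mulr_ge0 ?sqrtr_ge0// ltW.
rewrite !exprMn aE bE sqE.
have -> : q%:R / A * (q%:R / Y * Y ^+ 2) = q%:R ^+ 2 * (Y / A) :> R by field; rewrite An gt_eqF.
have -> : 28 ^+ 2 * q%:R ^+ 2 * q%:R = q%:R ^+ 2 * (28 ^+ 2 * q%:R) :> R by rewrite mulrAC mulrC mulrA.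
by rewrite ler_pM2l ?exprn_gt0// ler_pdivrMr.
Qed.

Section lower.
Variables (k del : R).
Hypothesis k01 : 0 <= k <= 1.
Hypothesis del0 : 0 < del.
Hypothesis hk : 0 <= \sum_(i < 5) coshpoly_coef k i * expR ((i%:R - 2) ^+ 2 / 2)
  <= expR (- del).

(** For |u| = 1 this is Markov's inequality: exp(-2 |A^T u|^2) has mean at most exp(- del q) and is
    at least exp(- del q / 2) on the event. *)
Lemma prob_sum_colform_small u : 0 < \sum_i u i ^+ 2 ->
  (P [set w | (\sum_j col u j w ^+ 2 <= del / 4 * q%:R * \sum_i u i ^+ 2)%R] <=
   (expR (- (del / 2) * q%:R))%:E)%E.
Proof.
set A := \sum_i _ => A0.
pose s := Num.sqrt A^-1.
have sE : s ^+ 2 = A^-1 by rewrite sqr_sqrtr// invr_ge0 ltW.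
have su1 : \sum_i (s * u i) ^+ 2 = 1.
  under eq_bigr do rewrite exprMn.
  by rewrite -mulr_sumr sE -/A mulVf ?gt_eqF.
have mY (v : 'I_p -> R) : measurable_fun setT (fun w => \sum_j col v j w ^+ 2).
  exact: measurable_sum_colform.
have mE (v : 'I_p -> R) : measurable_fun setT (fun w => expR (- 2 * \sum_j col v j w ^+ 2)).
  by apply: measurableT_comp => //; apply: measurable_funM.
pose su i := s * u i.
apply: le_trans (@prob_le_integral _ _ _ P _ (fun w => expR (del / 2 * q%:R) *
    expR (- 2 * \sum_j col su j w ^+ 2)) _ _ _ _) _.
- exact: measurable_set_le.
- exact: measurable_funM.
- by move=> w; rewrite mulr_ge0 ?expR_ge0.
- move=> w /= hw; rewrite -expRD; apply: le_trans (expR_ge1Dx _).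
  rewrite sum_colformZ sE lerDl.
  have : A^-1 * \sum_j col u j w ^+ 2 <= del / 4 * q%:R.
    by rewrite mulrC ler_pdivrMr.
  by move: (A^-1 * _) => x; lra.
under eq_integral do rewrite EFinM.
rewrite ge0_integralZl_EFin ?expR_ge0//; last by apply/measurable_EFinP; exact: mE.
have := integral_exp_colform mX mgfX k01 hk su1.
move=> /(lee_wpmul2l (x := (expR (del / 2 * q%:R))%:E)); rewrite lee_fin expR_ge0 => /(_ isT).
move=> /le_trans; apply; rewrite -EFinM -expRD lee_fin ler_expR; lra.
Qed.

Variable a : nat.

(* Here the ball has squared radius p, not q as in upper_net, so that the net
   has at most 2 ^ ((a + 2) p) points, which is small against exp(del q). *)
Definition lower_net : {set {ffun 'I_p -> bool * 'I_(a * p).+1}} :=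
  [set z in lattice_net p (a * p) | 0 < \sum_i lattice_point R a z i ^+ 2]%SET.

Definition bad_lower : set T :=
  \big[setU/set0]_(z in lower_net)
    [set w | \sum_j col (lattice_point R a z) j w ^+ 2 <=
       del / 4 * q%:R * \sum_i lattice_point R a z i ^+ 2].

Lemma measurable_bad_lower : measurable bad_lower.
Proof.
apply: bigsetU_measurable => z _; apply: measurable_set_le.
exact: measurable_sum_colform.
Qed.

Lemma prob_bad_lower : (a.+2 * p)%:R <= del / 4 * q%:R ->
  (P bad_lower <= (expR (- (del / 4) * q%:R))%:E)%E.
Proof.
move=> apq.
apply: le_trans (prob_bigsetU_le (c := expR (- (del / 2) * q%:R)) _ _) _.
- move=> z _; apply: measurable_set_le; exact: measurable_sum_colform.
- by move=> z; rewrite inE => /andP[_ z0]; exact: prob_sum_colform_small.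
rewrite lee_fin.
apply: (@le_trans _ _ (expR (del / 4 * q%:R) * expR (- (del / 2) * q%:R))).
  rewrite ler_wpM2r ?expR_ge0//; apply: le_trans (le_expR_pow2 apq).
  apply: (@le_trans _ _ #|lattice_net p (a * p)|%:R).
    rewrite ler_nat; apply: subset_leq_card; apply/fintype.subsetP => z.
    by rewrite inE => /andP[].
  apply: le_trans (card_lattice_net _ _ _) _.
  have -> : 4 = 2 ^+ 2 :> R by rewrite expr2; ring.
  by rewrite -exprM -exprD ler_weXn2l ?ler1n//; lia.
by rewrite -expRD ler_expR; lra.
Qed.

(** Scale to |v|^2 = p and take a net point b near v. Then |b|^2 >= p / 4, so |A^T b|^2 >= del q p /
    16, whereas the upper estimate makes |A^T (v - b)|^2 at most del q p / 64 by the condition on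
    [a]. From |A^T b|^2 <= 2 |A^T v|^2 + 2 |A^T (v - b)|^2 there remains del q p / 64 for |A^T
    v|^2. *)
Lemma sum_colform_ge w u : (0 < q)%N -> (p <= q)%N -> (1 < a)%N ->
  16 * 28 ^+ 2 <= del / 4 * a%:R ^+ 2 ->
  ~ bad_upper w -> ~ bad_lower w ->
  del / 64 * q%:R * \sum_i u i ^+ 2 <= \sum_j col u j w ^+ 2.
Proof.
move=> q0 pq a1 ha bu bl; have qR : 0 < q%:R :> R by rewrite ltr0n.
set A := \sum_i u i ^+ 2.
have A0 : 0 <= A by exact: sum_sqr_ge0.
have [AE|An] := eqVneq A 0; first by rewrite AE mulr0 sum_sqr_ge0.
have Ap : 0 < A by rewrite lt_neqAle eq_sym An.
have p0 : 0 < p%:R :> R.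
  rewrite ltr0n lt0n; apply: contra_neq An => pE; rewrite /A big1// => i _.
  by have := ltn_ord i; rewrite [in X in (_ < X)%N -> _]pE.
pose s := Num.sqrt (p%:R / A).
have sE : s ^+ 2 = p%:R / A by rewrite sqr_sqrtr// divr_ge0// ltW.
pose v i := s * u i.
have vE : \sum_i v i ^+ 2 = p%:R.
  under eq_bigr do rewrite exprMn.
  by rewrite -mulr_sumr sE -/A divfK.
have hA : a%:R * (p%:R + p%:R) / 2 <= (a * p)%:R :> R by rewrite natrM; lra.
have vp : \sum_i v i ^+ 2 <= p%:R by rewrite vE.
have a0 : (0 < a)%N by exact: ltnW.
have aR : 2 <= a%:R :> R by rewrite (ler_nat _ 2).
have [z zN [z1 z2]] := @lattice_net_approx R a p (a * p) p%:R v a0 hA vp.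
set b := lattice_point R a z in z1 z2.
have ap4 : 4 <= a%:R ^+ 2 :> R by nra.
have pa : p%:R / a%:R ^+ 2 <= p%:R / 4 :> R.
  by rewrite ler_pM2l// lef_pV2 ?posrE//; lra.
have b4 : p%:R / 4 <= \sum_i b i ^+ 2.
  have h : \sum_i v i ^+ 2 <= 2 * \sum_i (v i - b i) ^+ 2 + 2 * \sum_i b i ^+ 2.
    rewrite !mulr_sumr -big_split/=; apply: ler_sum => i _.
    by have := sqr_ge0 (v i - 2 * b i); nra.
  by lra.
have bb : del / 4 * q%:R * \sum_i b i ^+ 2 <= \sum_j col b j w ^+ 2.
  rewrite leNgt; apply/negP => hlt; apply: bl.
  rewrite /bad_lower (bigD1 z) /=; last by rewrite inE zN/=; lra.
  by left; exact: ltW.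
have cvb : \sum_j col (fun i => v i - b i) j w ^+ 2 <= 28 ^+ 2 * q%:R * (p%:R / a%:R ^+ 2).
  apply: le_trans (sum_colform_le _ q0 pq bu) _.
  by rewrite ler_wpM2l// mulr_ge0// ler0n.
have c2 : \sum_j col b j w ^+ 2 <=
    2 * \sum_j col v j w ^+ 2 + 2 * \sum_j col (fun i => v i - b i) j w ^+ 2.
  rewrite !mulr_sumr -big_split/=; apply: ler_sum => j _; rewrite colformB.
  by have := sqr_ge0 (2 * col v j w - col b j w); nra.
have e2 : 28 ^+ 2 * q%:R * (p%:R / a%:R ^+ 2) <= del / 4 * q%:R * p%:R / 16.
  rewrite mulrA ler_pdivrMr ?exprn_gt0//; last by lra.
  rewrite -subr_ge0; have -> : del / 4 * q%:R * p%:R / 16 * a%:R ^+ 2 -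
      28 ^+ 2 * q%:R * p%:R =
    (del / 4 * a%:R ^+ 2 - 16 * 28 ^+ 2) * (q%:R * p%:R / 16) by field.
  by rewrite mulr_ge0 ?subr_ge0// divr_ge0// mulr_ge0// ltW.
have e1 : del / 4 * q%:R * (p%:R / 4) <= del / 4 * q%:R * \sum_i b i ^+ 2.
  by rewrite ler_wpM2l// mulr_ge0// ltW// divr_gt0.
have : del / 4 * q%:R * p%:R / 16 <= s ^+ 2 * \sum_j col u j w ^+ 2.
  rewrite -sum_colformZ -/v; move: e1 e2 bb cvb c2.
  by do 4 move: (\sum_j _); move: (_ * q%:R * (p%:R / _ ^+ 2)) => *; lra.
rewrite sE; move: (\sum_j _) => Y h.
have An0 : A != 0 by [].
have pn0 : p%:R != 0 :> R by rewrite gt_eqF.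
have -> : Y = (p%:R / A * Y) * (A / p%:R) by field; rewrite An0 pn0.
have -> : del / 64 * q%:R * A = (del / 4 * q%:R * p%:R / 16) * (A / p%:R) by field.
by rewrite ler_wpM2r// divr_ge0// ltW.
Qed.

End lower.
End block_bounds.

Lemma gaussian_block_bounds (R : realType) : exists (c C del : R) (K : nat),
  [/\ 0 < c, 0 < C, 0 < del, (0 < K)%N &
  forall d (T : measurableType d) (P : probability T R) (p q : nat)
    (X : 'I_p -> 'I_q -> T -> R),
  (forall i j, measurable_fun setT (X i j)) ->
  (forall a : 'I_p -> 'I_q -> R,
    (\int[P]_w (expR (\sum_i \sum_j a i j * X i j w))%:E =
     (expR ((\sum_i \sum_j a i j ^+ 2) / 2))%:E)%E) ->
  (K * p <= q)%N -> exists Bad : set T, [/\ measurable Bad,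
    (P Bad <= (2 * expR (- del * q%:R))%:E)%E & forall w, ~ Bad w ->
    forall u : 'I_p -> R,
      c * q%:R * \sum_i u i ^+ 2 <= \sum_j colform X u j w ^+ 2
        <= C * q%:R * \sum_i u i ^+ 2]].
Proof.
have [k [del [k01 del0 hk]]] := coshpoly_gaussian_mean R.
(* The mesh 1 / a must satisfy the condition of [sum_colform_ge] on a^2; as a <= a^2, a lower bound
   for [a] is enough. [K] below is chosen so that 2 ^ ((a + 2) p) is at most exp(del q / 4). *)
pose a := (Num.trunc (64 * 28 ^+ 2 / del)).+2.
have aP : 64 * 28 ^+ 2 / del <= a%:R.
  by apply: le_trans (ltW (truncnS_gt _)) _; rewrite ler_nat.
have a1 : (1 < a)%N by [].
clearbody a.
have a1R : 1 <= a%:R :> R by rewrite ler1n ltnW.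
have ha : 16 * 28 ^+ 2 <= del / 4 * a%:R ^+ 2.
  move: aP; rewrite ler_pdivrMr// => aP.
  have : a%:R * del <= a%:R ^+ 2 * del by rewrite ler_pM2r// ler_eXnr.
  have -> : del / 4 * a%:R ^+ 2 = a%:R ^+ 2 * del / 4 by field.
  by move: aP; move: (28 ^+ 2) (a%:R ^+ 2 * del) (a%:R * del) => x y z; lra.
pose K := (Num.trunc (a.+2%:R * 4 / del)).+1.
have KP : a.+2%:R * 4 / del <= K%:R by apply: ltW; exact: truncnS_gt.
have K0 : (0 < K)%N by [].
clearbody K.
exists (del / 64), (28 ^+ 2), (Num.min 1 (del / 4)), K; split => //.
- by rewrite divr_gt0.
- by rewrite lt_min ltr01 divr_gt0.
move=> d T P p q X mX mgfX Kpq.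
have [q0|q0] := posnP q.
  have p0 : p = 0%N.
    by move: Kpq; rewrite q0 leqn0 muln_eq0 -leqn0 leqNgt K0/= => /eqP.
  exists set0; split=> //.
    by rewrite measure0 lee_fin mulr_ge0 ?expR_ge0.
  move=> w _ u; subst p q.
  by rewrite !big_ord0 !mulr0 lexx.
have pq : (p <= q)%N by apply: leq_trans Kpq; rewrite leq_pmull.
exists (bad_upper X `|` bad_lower X del a); split.
- by apply: measurableU; [exact: measurable_bad_upper|exact: measurable_bad_lower].
- apply: le_trans (measureU2 _ _ _) _.
  + exact: measurable_bad_upper.
  + exact: measurable_bad_lower.
  apply: (@le_trans _ _ ((expR (- q%:R))%:E + (expR (- (del / 4) * q%:R))%:E)%E).
    apply: leeD; first exact: prob_bad_upper.
    apply: (prob_bad_lower mX mgfX k01 del0 hk).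
    move: KP; rewrite ler_pdivrMr// => KP.
    have : (K * p)%:R <= q%:R :> R by rewrite ler_nat.
    rewrite !natrM.
    have : 0 <= p%:R :> R by rewrite ler0n.
    by nra.
  rewrite -EFinD lee_fin mulr2n mulrDl mul1r.
  apply: lerD; rewrite ler_expR !mulNr lerN2.
    by rewrite -[X in _ <= X]mul1r ler_wpM2r// ge_min lexx.
  by rewrite ler_wpM2r// ge_min lexx orbT.
- move=> w bw u; apply/andP; split.
    apply: (sum_colform_ge del0 u q0 pq a1 ha) => b; apply: bw; [by left|by right].
  by apply: sum_colform_le => // b; apply: bw; left.
Qed.

(** * Column blocks and the transposed head block of a Gaussian matrix *)

Section gaussian_matrix_blocks.
Context d (T : measurableType d) (R : realType) (P : probability T R).
Variables (n : nat) (g : 'I_n -> nat -> {RV P >-> R}).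
Hypothesis hg : gaussian_matrix g.

Lemma gaussian_columns_mgf (s q : nat) (a : 'I_n -> 'I_q -> R) :
  (\int[P]_w (expR (\sum_i \sum_j a i j * g i (s + j)%N w))%:E =
   (expR ((\sum_i \sum_j a i j ^+ 2) / 2))%:E)%E.
Proof.
pose b (e : 'I_n * nat) := if insub (e.2 - s)%N is Some j then a e.1 j else 0.
have bE i (j : 'I_q) : b (i, s + j)%N = a i j by rewrite /b/= addKn valK.
have := gaussian_linear_mgf hg b
  (s := [seq (i, s + j)%N | i <- enum 'I_n, j <- map val (enum 'I_q)]).
rewrite allpairs_uniq ?enum_uniq ?(map_inj_uniq val_inj) ?enum_uniq//; last first.
  by move=> [i j] [i' j'] _ _ /= [-> /addnI ->].
move=> /(_ isT); under eq_integral do rewrite big_allpairs_dep big_enum/=.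
rewrite big_allpairs_dep big_enum/=.
have E (F : 'I_n -> nat -> R) : \sum_i \sum_(j <- map val (enum 'I_q)) F i j =
    \sum_i \sum_(j < q) F i j.
  by apply: eq_bigr => i _; rewrite big_map big_enum.
rewrite E; under eq_integral do rewrite E.
have -> : \sum_i \sum_(j < q) b (i, s + j)%N ^+ 2 = \sum_i \sum_j a i j ^+ 2.
  by apply: eq_bigr => i _; apply: eq_bigr => j _; rewrite bE.
move=> <-; apply: eq_integral => w _; congr (expR _)%:E.
by apply: eq_bigr => i _; apply: eq_bigr => j _; rewrite bE.
Qed.

(** Here the first [k] columns are the short side and the [n] rows the long one, so the block
    estimate bounds |G v| from below for v supported on the first [k] coordinates. *)
Lemma gaussian_rows_mgf (k : nat) (a : 'I_k -> 'I_n -> R) :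
  (\int[P]_w (expR (\sum_j \sum_i a j i * g i j w))%:E =
   (expR ((\sum_j \sum_i a j i ^+ 2) / 2))%:E)%E.
Proof.
rewrite exchange_big -(gaussian_columns_mgf 0 (fun i j => a j i)).
by apply: eq_integral => w _; rewrite exchange_big.
Qed.

Lemma colform_columns (s q : nat) (v : 'I_n -> R) w :
  \sum_(j < q) colform (fun i (j : 'I_q) => (g i (s + j)%N : T -> R)) v j w ^+ 2 =
  \sum_(s <= j < s + q) (\sum_i v i * g i j w) ^+ 2.
Proof.
rewrite -[X in \sum_(X <= _ < _) _]add0n big_addn addKn big_mkord.
by apply: eq_bigr => j _; rewrite /colform addnC.
Qed.

End gaussian_matrix_blocks.

(** * Deterministic bounds for the radius *)

Section sequence_norms.
Variable R : realType.
Implicit Types (x sigma : nat -> R) (B : R).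

Lemma norm2E x : norm2 x = sqrte (\sum_(0 <= k <oo) (x k ^+ 2)%:E)%E.
Proof.
rewrite /norm2 Lnorm_counting// poweR12_sqrt; last first.
  by apply: nneseries_ge0 => k _ _; exact: poweR_ge0.
congr sqrte; apply: eq_eseriesr => k _.
rewrite [`|_|%E](_ : _ = `|x k|%:E)// poweR_EFin powR_mulrn//.
by rewrite real_normK// num_real.
Qed.

Lemma nneseries_le_partial (u : nat -> R) B : (forall k, 0 <= u k) ->
  ((\sum_(0 <= k <oo) (u k)%:E <= B%:E)%E <->
   forall M, \sum_(0 <= k < M) u k <= B).
Proof.
move=> u0; split=> [h M|h].
  rewrite -lee_fin -sumEFin; apply: le_trans h.
  by apply: nneseries_lim_ge => k _ _; rewrite lee_fin.
apply: lime_le; first by apply: is_cvg_nneseries => k _ _; rewrite lee_fin.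
by apply: nearW => M; rewrite sumEFin lee_fin.
Qed.

Lemma norm2_le x B : 0 <= B -> (forall M, \sum_(0 <= k < M) x k ^+ 2 <= B ^+ 2) ->
  (norm2 x <= B%:E)%E.
Proof.
move=> B0 h; rewrite norm2E.
have : (\sum_(0 <= k <oo) (x k ^+ 2)%:E <= (B ^+ 2)%:E)%E.
  by apply/nneseries_le_partial => // k; rewrite sqr_ge0.
rewrite -lee_sqrt ?lee_fin ?sqr_ge0// => /le_trans; apply.
by rewrite /= sqrtr_sqr ger0_norm.
Qed.

Lemma norm2_ge0 x : (0 <= norm2 x)%E.
Proof. exact: Lnorm_ge0. Qed.

Lemma norm2_ge_coord x k : (`|x k|%:E <= norm2 x)%E.
Proof.
rewrite norm2E.
have : ((x k ^+ 2)%:E <= \sum_(0 <= k <oo) (x k ^+ 2)%:E)%E.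
  apply: le_trans (nneseries_lim_ge k.+1 _); last first.
    by move=> j _ _; rewrite lee_fin sqr_ge0.
  rewrite sumEFin lee_fin big_nat_recr//= lerDr.
  by apply: sumr_ge0 => j _; rewrite sqr_ge0.
rewrite -lee_sqrt; last by apply: nneseries_ge0 => j _ _; rewrite lee_fin sqr_ge0.
apply: le_trans.
by rewrite /= sqrtr_sqr.
Qed.

Lemma ell2_bounded x B : (forall M, \sum_(0 <= k < M) x k ^+ 2 <= B) -> ell2 x.
Proof.
move=> h; have B0 : 0 <= B by have := h 0%N; rewrite big_nil.
rewrite /ell2/= /finite_norm; apply: (@le_lt_trans _ _ (Num.sqrt B)%:E); last exact: ltry.
by apply: norm2_le => // M; rewrite sqr_sqrtr.
Qed.

Lemma weighted_sum_le sigma x B : (forall k, 0 < sigma k) ->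
  ((weighted_sum sigma x <= B%:E)%E <->
   forall M, \sum_(0 <= k < M) (x k / sigma k) ^+ 2 <= B).
Proof.
move=> s0; rewrite -nneseries_le_partial; last by move=> k; rewrite sqr_ge0.
rewrite /weighted_sum; have -> // : (\sum_(0 <= j <oo) ((x j)%:E / (sigma j)%:E) ^+ 2)%E =
   (\sum_(0 <= j <oo) ((x j / sigma j) ^+ 2)%:E)%E.
by apply: eq_eseriesr => k _; rewrite inver gt_eqF// -EFinM EFin_expe.
Qed.

Lemma ellipsoid_partial sigma x : (forall k, 0 < sigma k) -> ellipsoid sigma x ->
  forall M, \sum_(0 <= k < M) (x k / sigma k) ^+ 2 <= 1.
Proof. by move=> s0 [_ /weighted_sum_le]; exact. Qed.

Lemma sum_sqr_le_weighted sigma x (m M : nat) : (forall k, 0 < sigma k) ->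
  nonincreasing_seq sigma ->
  \sum_(m <= k < M) x k ^+ 2 <= sigma m ^+ 2 * \sum_(m <= k < M) (x k / sigma k) ^+ 2.
Proof.
move=> s0 sn; rewrite mulr_sumr; apply: ler_sum_nat => k /andP[mk _].
rewrite -{1}[x k](divfK (lt0r_neq0 (s0 k))) exprMn mulrC ler_wpM2r ?sqr_ge0//.
by rewrite lerXn2r ?nnegrE ?(ltW (s0 _))//; exact: sn.
Qed.

Lemma ellipsoidP sigma x : (forall k, 0 < sigma k) -> nonincreasing_seq sigma ->
  (forall M, \sum_(0 <= k < M) (x k / sigma k) ^+ 2 <= 1) -> ellipsoid sigma x.
Proof.
move=> s0 sn h; split; last exact/weighted_sum_le.
apply: (@ell2_bounded _ (sigma 0%N ^+ 2)) => M.
apply: le_trans (sum_sqr_le_weighted _ _ _ s0 sn) _.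
by rewrite ler_piMr ?sqr_ge0.
Qed.

End sequence_norms.

Section radius_bounds.
Variables (R : realType) (n : nat) (sigma : nat -> R).
Hypothesis sigma_gt0 : forall k, 0 < sigma k.
Hypothesis sigma_ninc : nonincreasing_seq sigma.

Lemma radius_ge0 (g : 'I_n -> nat -> R) : (0 <= radius_of_information sigma g)%E.
Proof.
apply: le_ereal_inf_tmp => _ [phi _ <-].
apply: le_trans (norm2_ge0 _) (ereal_sup_ubound _).
exists (fun=> 0) => //; apply: ellipsoidP => // M.
by rewrite big1// => k _; rewrite mul0r expr0n.
Qed.

Lemma radius_le_first (g : 'I_n -> nat -> R) :
  (radius_of_information sigma g <= (sigma 0%N)%:E)%E.
Proof.
apply: (@le_trans _ _ (ereal_sup [set norm2 ((fun=> 0) \- x) | x in ellipsoid sigma])).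
  apply: ereal_inf_lbound; exists (fun=> (fun=> 0)) => // y _.
  by apply: (@ell2_bounded _ _ 0) => M; rewrite big1// => k _; rewrite expr0n.
apply: ge_ereal_sup => _ [x xE <-].
apply: norm2_le => [|M]; first exact: ltW.
under eq_bigr do rewrite /= sub0r sqrrN.
apply: le_trans (sum_sqr_le_weighted _ _ _ sigma_gt0 sigma_ninc) _.
by rewrite ler_piMr ?sqr_ge0//; exact: ellipsoid_partial.
Qed.

(* The points x and - x have the same information, so one of them is at
   distance at least |x_1| from its reconstruction. *)
Lemma radius_ge_kernel (g : 'I_n -> nat -> R) (x : nat -> R) (N : nat) :
  ellipsoid sigma x -> (forall j, (N <= j)%N -> x j = 0) ->
  (forall i, \sum_(0 <= j < N) g i j * x j = 0) ->
  (`|x 0%N|%:E <= radius_of_information sigma g)%E.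
Proof.
move=> xE xN gx.
have nxE : ellipsoid sigma (fun j => - x j).
  apply: ellipsoidP => // M; under eq_bigr do rewrite mulNr sqrrN.
  exact: ellipsoid_partial.
have info0 (s : R) : info g (fun j => s * x j) = fun=> Some 0.
  apply/funext => i; rewrite /info.
  (* With finite support the partial sums are eventually constant, so the information is [Some 0]
     and not NaN. *)
  have cv : series (fun j => g i j * (s * x j)) @ \oo --> (0 : R).
    apply: cvg_near_cst.
    near=> M.
    have NM : (N <= M)%N by near: M; exists N.
    rewrite /series/= (big_cat_nat (n := N))//=.
    rewrite [X in _ + X]big_nat [X in _ + X]big1 ?addr0; last first.
      by move=> j /andP[Nj _]; rewrite xN// !mulr0.
    under eq_bigr do rewrite mulrCA.
    by rewrite -mulr_sumr gx mulr0.
  case: pselect => [c|]; last by case; apply/cvg_ex; exists 0.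
  by congr Some; apply/cvg_lim.
apply: le_ereal_inf_tmp => _ [phi _ <-].
pose y := phi (fun=> Some 0).
have i1 : info g x = fun=> Some 0 by rewrite -(info0 1); congr info; apply/funext => j; rewrite mul1r.
have i2 : info g (fun j => - x j) = fun=> Some 0.
  by rewrite -(info0 (- 1)); congr info; apply/funext => j; rewrite mulN1r.
have [h|h] : `|x 0%N| <= `|y 0%N - x 0%N| \/ `|x 0%N| <= `|y 0%N + x 0%N|.
  have := ler_normD (y 0%N + x 0%N) (- (y 0%N - x 0%N)); rewrite normrN.
  have -> : y 0%N + x 0%N - (y 0%N - x 0%N) = 2 * x 0%N by ring.
  rewrite normrM [`|2|]ger0_norm//.
  by have [|] := leP `|x 0%N| `|y 0%N - x 0%N|; [left|right; lra].
- apply: (@le_trans _ _ (norm2 (y \- x))).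
    by apply: le_trans (norm2_ge_coord _ 0%N); rewrite lee_fin.
  by apply: ereal_sup_ubound; exists x => //; rewrite i1.
- apply: (@le_trans _ _ (norm2 (y \- (fun j => - x j)))).
    by apply: le_trans (norm2_ge_coord _ 0%N); rewrite lee_fin /= opprK.
  by apply: ereal_sup_ubound; exists (fun j => - x j) => //; rewrite i2.
Unshelve. all: by end_near. Qed.

(** [phi] returns some point of the ellipsoid with the observed information. The difference from the
    true point lies in the kernel and has weighted sum at most 2 + 2 = 4. Convergence is demanded on
    the whole ellipsoid because two equal NaN values would not give G e = 0. *)
Lemma radius_le_kernel (g : 'I_n -> nat -> R) (B : R) : 0 <= B ->
  (forall i x, ellipsoid sigma x -> cvgn (series (fun j => g i j * x j))) ->
  (forall e : nat -> R, (forall M, \sum_(0 <= k < M) (e k / sigma k) ^+ 2 <= 4) ->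
     (forall i, series (fun j => g i j * e j) @ \oo --> (0 : R)) ->
     forall M, \sum_(0 <= k < M) e k ^+ 2 <= B ^+ 2) ->
  (radius_of_information sigma g <= B%:E)%E.
Proof.
move=> B0 gcv hB.
pose phi (y : 'I_n -> option R) : nat -> R :=
  if pselect (exists2 x, ellipsoid sigma x & info g x = y) is left h
  then projT1 (cid2 h) else fun=> 0.
have phiP x : ellipsoid sigma x ->
    ellipsoid sigma (phi (info g x)) /\ info g (phi (info g x)) = info g x.
  move=> xE; rewrite /phi; case: pselect => [h|]; last by case; exists x.
  by case: (cid2 h).
apply: (@le_trans _ _ (ereal_sup [set norm2 (phi (info g x) \- x) | x in ellipsoid sigma])).
  apply: ereal_inf_lbound; exists phi => // y _; rewrite /phi.
  case: pselect => [h|_]; first by case: (cid2 h) => x [].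
  by apply: (@ell2_bounded _ _ 0) => M; rewrite big1// => k _; rewrite expr0n.
apply: ge_ereal_sup => _ [x xE <-].
have [zE zi] := phiP x xE; move: (phi _) zE zi => z zE zi.
apply: norm2_le => // ; apply: hB => [M|i].
  apply: (@le_trans _ _ (\sum_(0 <= k < M) (2 * (z k / sigma k) ^+ 2 + 2 * (x k / sigma k) ^+ 2))).
    apply: ler_sum => k _; rewrite /= mulrBl.
    by have := sqr_ge0 (z k / sigma k + x k / sigma k); nra.
  rewrite big_split/= -!mulr_sumr.
  have := ellipsoid_partial sigma_gt0 zE M; have := ellipsoid_partial sigma_gt0 xE M.
  by lra.
have /(congr1 (fun f => f i)) := zi; rewrite /info.
case: pselect => [cz|/(_ (gcv i _ zE))//]; case: pselect => [cx|/(_ (gcv i _ xE))//] [lzx].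
have -> : series (fun j => g i j * (z \- x) j) =
    series (fun j => g i j * z j) \- series (fun j => g i j * x j).
  apply/funext => M; rewrite /series/= -sumrB; apply: eq_bigr => j _.
  by rewrite mulrBr.
by rewrite -(subrr (limn (series (fun j => g i j * x j)))) -{1}lzx; exact: cvgB.
Qed.

End radius_bounds.

(** * Lower bound: a kernel vector with a large first coordinate *)

Section lower_kernel.
Variables (R : realType) (n : nat) (sigma : nat -> R) (g : 'I_n -> nat -> R).
Hypothesis sigma_gt0 : forall k, 0 < sigma k.
Hypothesis sigma_ninc : nonincreasing_seq sigma.
Variables (N M : nat) (D lam t : R).
Hypothesis N0 : (0 < N)%N.
Hypothesis NM : (N <= M)%N.
Hypothesis upperN : forall v : 'I_n -> R,
  \sum_(0 <= j < N) (\sum_i v i * g i j) ^+ 2 <= D * \sum_i v i ^+ 2.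
Hypothesis lowerM : forall v : 'I_n -> R,
  lam * \sum_i v i ^+ 2 <= \sum_(N <= j < M) sigma j ^+ 2 * (\sum_i v i * g i j) ^+ 2.
Hypothesis lam0 : 0 < lam.
Hypothesis D0 : 0 <= D.
Hypothesis t0 : 0 <= t.
Hypothesis ht : t ^+ 2 * (sigma 0%N ^- 2 + D / lam) <= 1.

(** Testing [upperN] with the first column as v and keeping only the term j = 0 gives A^2 <= D A for
    its squared norm A. *)
Lemma first_column_le : \sum_i g i 0%N ^+ 2 <= D.
Proof.
have := upperN (g ^~ 0%N); set A := \sum_i _ => h.
have A0 : 0 <= A by apply: sumr_ge0 => i _; rewrite sqr_ge0.
have [->//|An] := eqVneq A 0.
rewrite -(@ler_pM2r _ A) ?lt_neqAle 1?eq_sym ?An//; apply: le_trans h.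
have -> : A * A = (\sum_i g i 0%N * g i 0%N) ^+ 2.
  by rewrite -expr2; congr (_ ^+ 2); apply: eq_bigr => i _; rewrite expr2.
by rewrite big_ltn// lerDl; apply: sumr_ge0 => j _; rewrite sqr_ge0.
Qed.

(* The kernel vector is t e_1 + sum_j sigma_j^2 <g_j, z> e_j with j in [N, M),
   where z solves G z = - t g_1 for G = sum_j sigma_j^2 g_j g_j^T. *)
Lemma radius_ge_gram : (t%:E <= radius_of_information sigma g)%E.
Proof.
pose G : 'M[R]_n := \matrix_(i, i') \sum_(N <= j < M) sigma j ^+ 2 * (g i j * g i' j).
have GE (v : 'rV[R]_n) i' : (v *m G) 0 i' =
    \sum_(N <= j < M) sigma j ^+ 2 * (\sum_i v 0 i * g i j) * g i' j.
  rewrite mxE; under eq_bigr do rewrite mxE mulr_sumr.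
  rewrite exchange_big/=; apply: eq_bigr => j _.
  rewrite mulr_sumr mulr_suml; apply: eq_bigr => i _; ring.
have GQ (v : 'rV[R]_n) : \sum_i' (v *m G) 0 i' * v 0 i' =
    \sum_(N <= j < M) sigma j ^+ 2 * (\sum_i v 0 i * g i j) ^+ 2.
  under eq_bigr do rewrite GE mulr_suml.
  rewrite exchange_big/=; apply: eq_bigr => j _.
  pose S := \sum_(i < n) v 0 i * g i j.
  transitivity (\sum_(i < n) sigma j ^+ 2 * S * (v 0 i * g i j)).
    by apply: eq_bigr => i _; rewrite -/S; ring.
  by rewrite -mulr_sumr -/S -mulrA -expr2.
have Gu : G \in unitmx.
  rewrite -row_free_unit; apply: inj_row_free => v vG0; apply/rowP => i; rewrite mxE.
  have := lowerM (v 0); rewrite -GQ vG0 [leRHS]big1; last by move=> j _; rewrite mxE mul0r.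
  rewrite pmulr_rle0// => h.
  by apply: (@sum_sqr_eq0 _ _ (v 0)); apply/eqP; rewrite eq_le h sum_sqr_ge0.
pose b : 'rV[R]_n := \row_i (- t * g i 0%N).
pose z := b *m invmx G.
have zG : z *m G = b by rewrite /z mulmxKV.
pose y j := \sum_i z 0 i * g i j.
pose x j := if j == 0%N then t else if (N <= j < M)%N then sigma j ^+ 2 * y j else 0.
have M0 : (0 < M)%N by apply: leq_trans NM.
have xsplit (F : nat -> R -> R) : (forall j, F j 0 = 0) ->
    \sum_(0 <= j < M) F j (x j) = F 0%N t + \sum_(N <= j < M) F j (sigma j ^+ 2 * y j).
  move=> F0; rewrite big_ltn// (big_cat_nat (n := N))//=; congr (_ + _).
  rewrite big_nat [X in X + _]big1 ?add0r; last first.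
    move=> j /andP[j0 jN]; rewrite /x gtn_eqF// leqNgt jN/=; exact: F0.
  rewrite big_nat [RHS]big_nat; apply: eq_bigr => j /andP[Nj jM].
  by rewrite /x gtn_eqF ?Nj ?jM// (leq_trans N0).
set Q := \sum_(N <= j < M) sigma j ^+ 2 * y j ^+ 2.
have QE : Q = - t * \sum_i g i 0%N * z 0 i.
  rewrite /Q -GQ zG mulr_sumr; apply: eq_bigr => i _; rewrite mxE; ring.
have Q0 : 0 <= Q by apply: sumr_ge0 => j _; rewrite mulr_ge0 ?sqr_ge0.
(* [Q] is the weighted sum of squares of the correction and equals the quadratic form of [G] at z,
   that is - t <g_1, z>. Cauchy-Schwarz gives Q^2 <= t^2 D |z|^2, and [lowerM] gives lam |z|^2 <= Q,
   so one factor Q cancels. *)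
have Qle : Q <= t ^+ 2 * (D / lam).
  have [->|Qn] := eqVneq Q 0.
    by rewrite mulr_ge0 ?sqr_ge0// divr_ge0 ?(ltW lam0).
  rewrite -(@ler_pM2r _ Q) ?lt_neqAle 1?eq_sym ?Qn// -expr2.
  have -> : Q ^+ 2 = t ^+ 2 * (\sum_i g i 0%N * z 0 i) ^+ 2 by rewrite QE; ring.
  rewrite -[leRHS]mulrA; apply: ler_wpM2l; first exact: sqr_ge0.
  apply: le_trans (cauchy_schwarz _ _ _) _.
  rewrite mulrAC -mulrA; apply: ler_pM; rewrite ?sum_sqr_ge0//.
    exact: first_column_le.
  by rewrite ler_pdivlMr// mulrC; exact: lowerM.
have xE : ellipsoid sigma x.
  apply: ellipsoidP => // L.
  have xge0 j : 0 <= (x j / sigma j) ^+ 2 by rewrite sqr_ge0.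
  have : \sum_(0 <= j < M) (x j / sigma j) ^+ 2 <= 1.
    rewrite (xsplit (fun j a => (a / sigma j) ^+ 2)); last by move=> j; rewrite mul0r expr0n.
    apply: le_trans ht; rewrite mulrDr exprMn exprVn lerD2l.
    have -> // : \sum_(N <= j < M) (sigma j ^+ 2 * y j / sigma j) ^+ 2 = Q.
    apply: eq_bigr => j _; have := gt_eqF (sigma_gt0 j) => /negbT sn; by field.
  apply: le_trans; have [LM|ML] := leqP L M.
    rewrite [leRHS](big_cat_nat (n := L))//= lerDl; exact: sumr_ge0.
  rewrite (big_cat_nat (n := M))//=; last exact: ltnW.
  rewrite [X in _ + X]big_nat [X in _ + X]big1 ?addr0// => j /andP[Mj _].
  rewrite /x gtn_eqF ?(leq_trans M0)// [(j < M)%N]ltnNge Mj andbF mul0r.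
  by rewrite expr0n.
have -> : t = `|x 0%N| by rewrite /x eqxx ger0_norm.
apply: (@radius_ge_kernel _ _ sigma sigma_gt0 sigma_ninc g x M) => // [j Mj|i].
  by rewrite /x gtn_eqF ?(leq_trans M0)// [(j < M)%N]ltnNge Mj andbF.
rewrite (xsplit (fun j a => g i j * a)); last by move=> j; rewrite mulr0.
have := GE z i; rewrite zG mxE.
under [in X in _ -> X]eq_bigr do rewrite mulrC.
by move=> <-; ring.
Qed.

End lower_kernel.

Section dyadic_blocks.
Variables (R : realType) (u w : nat -> R) (N : nat) (c C A : R).
Hypothesis N0 : (0 < N)%N.
Hypothesis u0 : forall j, 0 <= u j.
Hypothesis u_ninc : nonincreasing_seq u.
Hypothesis w0 : forall j, 0 <= w j.

(** On the block from N 2^l to N 2^(l+1) a nonincreasing [u] is at least its value at the right end,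
    whereas [dyadic_sum_le] takes the left end; hence the exponents differ by one. *)
Lemma dyadic_sum_ge (L : nat) :
  (forall l, (l < L)%N ->
    c * (N * 2 ^ l)%:R * A <= \sum_(N * 2 ^ l <= j < N * 2 ^ l + N * 2 ^ l) w j) ->
  c * N%:R * (\sum_(l < L) 2 ^+ l * u (N * 2 ^ l.+1)%N) * A <=
  \sum_(N <= j < N * 2 ^ L) u j * w j.
Proof.
elim: L => [_|L IH h].
  by rewrite big_ord0 mulr0 mul0r; apply: sumr_ge0 => j _; rewrite mulr_ge0.
have E : (N * 2 ^ L.+1 = N * 2 ^ L + N * 2 ^ L)%N by rewrite expnS; lia.
rewrite (big_cat_nat (n := (N * 2 ^ L)%N))/=; last 2 first.
- by rewrite leq_pmulr// expn_gt0.
- by rewrite E leq_addr.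
rewrite big_ord_recr/= mulrDr mulrDl; apply: lerD.
  by apply: IH => l lL; apply: h; exact: ltnW.
apply: (@le_trans _ _ (u (N * 2 ^ L.+1)%N * (c * (N * 2 ^ L)%:R * A))).
  by rewrite natrM natrX le_eqVlt; apply/orP; left; apply/eqP; ring.
apply: le_trans (ler_wpM2l (u0 _) (h L _)) _ => //.
rewrite mulr_sumr E; apply: ler_sum_nat => j /andP[_ jL].
by rewrite ler_wpM2r//; apply: u_ninc; exact: ltnW.
Qed.

Lemma dyadic_sum_le (L : nat) :
  (forall l, \sum_(N * 2 ^ l <= j < N * 2 ^ l + N * 2 ^ l) w j
     <= C * (N * 2 ^ l)%:R * A) ->
  \sum_(N <= j < N * 2 ^ L) u j * w j <=
  C * N%:R * (\sum_(l < L) 2 ^+ l * u (N * 2 ^ l)%N) * A.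
Proof.
move=> h; elim: L => [|L IH].
  by rewrite expn0 muln1 big_geq// big_ord0 mulr0 mul0r.
have E : (N * 2 ^ L.+1 = N * 2 ^ L + N * 2 ^ L)%N by rewrite expnS; lia.
rewrite (big_cat_nat (n := (N * 2 ^ L)%N))/=; last 2 first.
- by rewrite leq_pmulr// expn_gt0.
- by rewrite E leq_addr.
rewrite big_ord_recr/= mulrDr mulrDl; apply: lerD => //.
apply: (@le_trans _ _ (u (N * 2 ^ L)%N * (C * (N * 2 ^ L)%:R * A))); last first.
  by rewrite natrM natrX le_eqVlt; apply/orP; left; apply/eqP; ring.
apply: le_trans (ler_wpM2l (u0 _) (h L)).
rewrite mulr_sumr E; apply: ler_sum_nat => j /andP[jL _].
by rewrite ler_wpM2r//; apply: u_ninc.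
Qed.

End dyadic_blocks.

(** * Upper bound: kernel vectors are short *)

Section upper_kernel.
Variables (R : realType) (n : nat) (sigma : nat -> R) (g : 'I_n -> nat -> R).
Hypothesis sigma_gt0 : forall k, 0 < sigma k.
Hypothesis sigma_ninc : nonincreasing_seq sigma.
Variables (N k : nat) (c C S : R).
Hypothesis n0 : (0 < n)%N.
Hypothesis N0 : (0 < N)%N.
Hypothesis kN : (k <= N)%N.
Hypothesis c0 : 0 < c.
Hypothesis C0 : 0 < C.
Hypothesis upperN : forall v : 'I_n -> R,
  \sum_(0 <= j < N) (\sum_i v i * g i j) ^+ 2 <= C * N%:R * \sum_i v i ^+ 2.
Hypothesis upperl : forall l (v : 'I_n -> R),
  \sum_(N * 2 ^ l <= j < N * 2 ^ l + N * 2 ^ l) (\sum_i v i * g i j) ^+ 2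
    <= C * (N * 2 ^ l)%:R * \sum_i v i ^+ 2.
Hypothesis lowerk : forall v : 'I_k -> R,
  c * n%:R * \sum_j v j ^+ 2 <= \sum_i (\sum_j v j * g i j) ^+ 2.
Hypothesis hS : forall L, \sum_(l < L) 2 ^+ l * sigma (N * 2 ^ l)%N ^+ 2 <= S.

Let D := C * N%:R * (sigma k ^+ 2 + S).

Let S0 : 0 <= S. Proof. by have := hS 0; rewrite big_ord0. Qed.

Let D0 : 0 <= D.
Proof. by rewrite mulr_ge0 ?mulr_ge0 ?(ltW C0)// addr_ge0// sqr_ge0. Qed.

Let sqs j : 0 <= sigma j ^+ 2. Proof. exact: sqr_ge0. Qed.

Let sqs_ninc : nonincreasing_seq (fun j => sigma j ^+ 2).
Proof.
by move=> i j ij; rewrite lerXn2r ?nnegrE ?(ltW (sigma_gt0 _))//; exact: sigma_ninc.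
Qed.

(** Columns from [k] to [N] cost sigma_(k+1)^2 times [upperN], and later ones are treated dyadically
    after raising [M] to N 2^M. In transposed form this bounds the norm of G on the part of the
    ellipsoid beyond [k]. *)
Lemma weighted_tail_le M (v : 'I_n -> R) :
  \sum_(k <= j < M) sigma j ^+ 2 * (\sum_i v i * g i j) ^+ 2 <= D * \sum_i v i ^+ 2.
Proof.
set A := \sum_i v i ^+ 2; have A0 : 0 <= A by exact: sum_sqr_ge0.
pose w j := (\sum_i v i * g i j) ^+ 2.
have w0 j : 0 <= w j by exact: sqr_ge0.
have [Mk|kM] := leqP M k.
  by rewrite big_geq// mulr_ge0.
have MN : (M <= N * 2 ^ M)%N.
  by apply: leq_trans (ltnW (ltn_expl _ (isT : (1 < 2)%N))) _; rewrite leq_pmull.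
apply: (@le_trans _ _ (\sum_(k <= j < N * 2 ^ M) sigma j ^+ 2 * w j)).
  rewrite [leRHS](big_cat_nat (n := M)) ?(ltnW kM)//= lerDl.
  by apply: sumr_ge0 => j _; rewrite mulr_ge0.
rewrite (big_cat_nat (n := N))//=; last by rewrite leq_pmulr// expn_gt0.
rewrite /D mulrDr mulrDl; apply: lerD.
  apply: (@le_trans _ _ (sigma k ^+ 2 * \sum_(k <= j < N) w j)).
    rewrite mulr_sumr; apply: ler_sum_nat => j /andP[kj _].
    by rewrite ler_wpM2r//; exact: sqs_ninc.
  rewrite -mulrA [sigma k ^+ 2 * A]mulrC mulrA mulrC ler_wpM2r//.
  apply: le_trans (upperN v).
  rewrite [leRHS](big_cat_nat (n := k))//= lerDr; apply: sumr_ge0 => j _.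
  exact: sqr_ge0.
apply: le_trans (dyadic_sum_le N0 sqs sqs_ninc w0 M (fun l => upperl l v)) _.
by rewrite ler_wpM2r// ler_wpM2l// mulr_ge0// ltW.
Qed.

(** Testing [weighted_tail_le] with the i-th unit vector shows that sigma_j g_ij is square summable
    in j. The terms are products of these numbers and x_j / sigma_j, so the series converges
    absolutely. *)
Lemma info_series_cvg i x : ellipsoid sigma x -> cvgn (series (fun j => g i j * x j)).
Proof.
move=> xE; apply: normed_cvg.
rewrite -[X in cvgn X]/(series (fun j => `|g i j * x j|)).
pose B := \sum_(0 <= j < k) sigma j ^+ 2 * g i j ^+ 2 + D + 1.
have gB M : \sum_(0 <= j < M) sigma j ^+ 2 * g i j ^+ 2 <= B - 1.
  have h0 j : 0 <= sigma j ^+ 2 * g i j ^+ 2 by rewrite mulr_ge0// sqr_ge0.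
  have hD : \sum_(k <= j < M) sigma j ^+ 2 * g i j ^+ 2 <= D.
    have := weighted_tail_le M (fun i' => (i' == i)%:R).
    have -> : \sum_i' ((i' == i)%:R : R) ^+ 2 = 1.
      rewrite (bigD1 i)//= eqxx big1 ?expr1n ?addr0// => j /negbTE ->.
      by rewrite expr0n.
    rewrite mulr1; apply: le_trans; apply: ler_sum => j _.
    rewrite (bigD1 i)//= eqxx mul1r big1 ?addr0// => i' /negbTE ->.
    by rewrite mul0r.
  rewrite /B addrK; have [Mk|kM] := leqP M k.
    rewrite [X in _ <= X + _](big_cat_nat (n := M))//= -addrA lerDl.
    by rewrite addr_ge0// sumr_ge0.
  by rewrite (big_cat_nat (n := k)) ?(ltnW kM)//= lerD2l.
apply: nondecreasing_is_cvgn.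
  by apply/nondecreasing_seqP => M; rewrite /series/= big_nat_recr//= lerDl.
exists B => _ [M _ <-]; rewrite /series/=.
apply: (@le_trans _ _ (\sum_(0 <= j < M) (sigma j ^+ 2 * g i j ^+ 2 + (x j / sigma j) ^+ 2))).
  apply: ler_sum => j _.
  have -> : g i j * x j = (sigma j * g i j) * (x j / sigma j).
    have := lt0r_neq0 (sigma_gt0 j) => sn; by field.
  rewrite -exprMn ler_norml; move: (sigma j * g i j) (x j / sigma j) => a b.
  have := sqr_ge0 (a + b); have := sqr_ge0 (a - b).
  have := sqr_ge0 a; have := sqr_ge0 b.
  by move=> *; apply/andP; split; nra.
rewrite big_split/=; have := gB M; have := ellipsoid_partial sigma_gt0 xE M.
by lra.
Qed.

(** For h = G e_(>k), truncated at [M], |h|^2 is the pairing of sigma_j <g_j, h> with e_j / sigma_j;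
    Cauchy-Schwarz and [weighted_tail_le] give |h|^4 <= 4 D |h|^2. *)
Lemma kernel_tail_le (e : nat -> R) M :
  (forall M, \sum_(0 <= j < M) (e j / sigma j) ^+ 2 <= 4) ->
  \sum_i (\sum_(k <= j < M) g i j * e j) ^+ 2 <= 4 * D.
Proof.
move=> he; pose h i := \sum_(k <= j < M) g i j * e j.
set A := \sum_i _; have A0 : 0 <= A by exact: sum_sqr_ge0.
have [->|An] := eqVneq A 0; first by rewrite mulr_ge0.
have Ap : 0 < A by rewrite lt_neqAle eq_sym An.
have AE : A = \sum_(k <= j < M) (sigma j * \sum_i h i * g i j) * (e j / sigma j).
  transitivity (\sum_i \sum_(k <= j < M) h i * (g i j * e j)).
    by apply: eq_bigr => i _; rewrite -mulr_sumr -expr2.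
  rewrite exchange_big; apply: eq_bigr => j _.
  have sn := lt0r_neq0 (sigma_gt0 j).
  transitivity ((\sum_i h i * g i j) * e j); last by field.
  by rewrite mulr_suml; apply: eq_bigr => i _; rewrite mulrA.
rewrite -(ler_pM2r Ap) -expr2 {1}AE; apply: le_trans (cauchy_schwarz _ _ _) _.
rewrite -mulrA mulrC; apply: ler_pM.
- by apply: sumr_ge0 => j _; rewrite sqr_ge0.
- by apply: sumr_ge0 => j _; rewrite sqr_ge0.
- apply: le_trans (he M); have [kM|Mk] := leqP k M; last first.
    by rewrite big_geq ?(ltnW Mk)//; apply: sumr_ge0 => j _; rewrite sqr_ge0.
  rewrite [leRHS](big_cat_nat (n := k))//= lerDr.
  by apply: sumr_ge0 => j _; rewrite sqr_ge0.
- by under eq_bigr do rewrite exprMn; exact: weighted_tail_le.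
Qed.

(** G e = 0 holds only as a limit: G e_(<=k) is the limit of minus the truncated tails, which
    [kernel_tail_le] bounds uniformly in the truncation. *)
Lemma kernel_head_le (e : nat -> R) :
  (forall M, \sum_(0 <= j < M) (e j / sigma j) ^+ 2 <= 4) ->
  (forall i, series (fun j => g i j * e j) @ \oo --> (0 : R)) ->
  \sum_(0 <= j < k) e j ^+ 2 <= 4 * D / (c * n%:R).
Proof.
move=> he ge.
pose a i := \sum_(0 <= j < k) g i j * e j.
rewrite ler_pdivlMr ?mulr_gt0 ?ltr0n// mulrC big_mkord.
apply: le_trans (lowerk (fun j => e j)) _.
have -> : \sum_i (\sum_(j < k) e j * g i j) ^+ 2 = \sum_i a i ^+ 2.
  apply: eq_bigr => i _; rewrite /a big_mkord; congr (_ ^+ 2).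
  by apply: eq_bigr => j _; rewrite mulrC.
have cv : (fun M => \sum_i (a i - series (fun j => g i j * e j) M) ^+ 2) @ \oo
    --> \sum_i (a i - 0) ^+ 2.
  apply: cvg_big => [|i _]; first exact: add_continuous.
  by rewrite !expr2; apply: cvgM; (apply: cvgB; [exact: cvg_cst|exact: ge]).
have <- : \sum_i (a i - 0) ^+ 2 = \sum_i a i ^+ 2.
  by apply: eq_bigr => i _; rewrite subr0.
rewrite -(cvg_lim (@Rhausdorff R) cv).
apply: limr_le; first by apply/cvg_ex; eexists; exact: cv.
near=> M; have kM : (k <= M)%N by near: M; exists k.
apply: le_trans (kernel_tail_le M he); rewrite le_eqVlt; apply/orP; left; apply/eqP.
apply: eq_bigr => i _; rewrite /series/= (big_cat_nat (n := k))//= -/(a i).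
by rewrite opprD addNKr sqrrN.
Unshelve. all: by end_near. Qed.

Lemma radius_le_blocks :
  (radius_of_information sigma g <=
   (Num.sqrt (4 * (C * N%:R * (sigma k ^+ 2 + S) / (c * n%:R) + sigma k ^+ 2)))%:E)%E.
Proof.
apply: radius_le_kernel => //.
- by move=> i x; exact: info_series_cvg.
- move=> e he ge M; rewrite sqr_sqrtr; last first.
    by rewrite mulr_ge0// addr_ge0// divr_ge0// mulr_ge0// ltW.
  have tail M' : \sum_(k <= j < M') e j ^+ 2 <= 4 * sigma k ^+ 2.
    apply: le_trans (sum_sqr_le_weighted _ _ _ sigma_gt0 sigma_ninc) _.
    rewrite mulrC ler_wpM2r//; apply: le_trans (he M').
    have [kM|Mk] := leqP k M'; last first.
      by rewrite big_geq ?(ltnW Mk)//; apply: sumr_ge0 => j _; rewrite sqr_ge0.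
    rewrite [leRHS](big_cat_nat (n := k))//= lerDr.
    by apply: sumr_ge0 => j _; rewrite sqr_ge0.
  rewrite mulrDr mulrA; have [Mk|kM] := leqP M k.
    apply: le_trans (lerD (kernel_head_le he ge) (mulr_ge0 _ _ : 0 <= 4 * sigma k ^+ 2))=> //.
    rewrite addr0 [leRHS](big_cat_nat (n := M))//= lerDl.
    by apply: sumr_ge0 => j _; rewrite sqr_ge0.
  by rewrite (big_cat_nat (n := k)) ?(ltnW kM)//=; apply: lerD => //; exact: kernel_head_le.
Qed.

End upper_kernel.

(** * Dyadic sums of the semiaxes *)

Section log_facts.
Variable R : realType.
Implicit Types x y : R.

Lemma ln_le_linear (e : R) : 0 < e -> exists C : R, forall x, 0 < x -> ln x <= e * x + C.
Proof.
move=> e0; exists (- ln e) => x x0.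
have := expR_ge1Dx (ln (e * x)).
by rewrite lnK ?posrE ?mulr_gt0// lnM ?posrE//; lra.
Qed.

Lemma ln2_gt0 : 0 < ln 2 :> R.
Proof. by rewrite ln_gt0// ltr1n. Qed.

Lemma ln_natr_ge_ln2 (n : nat) : (0 < n)%N -> ln 2 <= ln n.+1%:R :> R.
Proof. by move=> n0; rewrite ler_ln ?posrE ?ltr0n// ler_nat. Qed.

Lemma ln_natr_gt0 (n : nat) : (0 < n)%N -> 0 < ln n.+1%:R :> R.
Proof. by move=> n0; apply: lt_le_trans ln2_gt0 (ln_natr_ge_ln2 n0). Qed.

Lemma ln_dyadic_ge (n l : nat) : (0 < n)%N ->
  ln n.+1%:R <= ln (n * 2 ^ l).+1%:R :> R.
Proof.
move=> n0; rewrite ler_ln ?posrE ?ltr0n// ler_nat ltnS.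
by rewrite leq_pmulr// expn_gt0.
Qed.

(** Since n 2^l + 1 <= (n + 1)^(l + 1), the iterated logarithm grows by at most ln(l + 1) along
    dyadic indices, uniformly in n. *)
Lemma ln_dyadic_le (n l : nat) : (0 < n)%N ->
  ln (n * 2 ^ l).+1%:R <= l.+1%:R * ln n.+1%:R :> R.
Proof.
move=> n0; rewrite mulr_natl -lnXn ?ltr0n// ler_ln ?posrE ?exprn_gt0 ?ltr0n//.
rewrite -natrX ler_nat expnS.
apply: (@leq_trans (n.+1 * 2 ^ l)).
  by rewrite mulSn -[(n * _).+1]add1n leq_add2r expn_gt0.
by rewrite leq_mul2l/=; case: l => [//|l]; rewrite leq_exp2r.
Qed.

Lemma sum_exp_geometric_le (e : R) (L : nat) : 0 < e ->
  \sum_(l < L) expR (- e * l%:R) <= (1 - expR (- e))^-1.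
Proof.
move=> e0; under eq_bigr do rewrite expRM_natr.
have r1 : expR (- e) < 1 by rewrite -expR0 ltr_expR oppr_lt0.
have r0 := expR_gt0 (- e).
rewrite -[leRHS]mul1r ler_pdivlMr ?subr_gt0// mulrC -opprB mulNr -subrX1.
by have := exprn_ge0 L (ltW r0); lra.
Qed.

Lemma harmonic_unbounded (B : R) : exists L, B <= \sum_(l < L) l.+1%:R^-1.
Proof.
exists (Num.trunc (expR B)).
have h L : ln L.+1%:R <= \sum_(l < L) l.+1%:R^-1 :> R.
  elim: L => [|L IH]; first by rewrite ln1 big_ord0.
  rewrite big_ord_recr/=; apply: le_trans (lerD IH (lexx _)).
  rewrite addrC -lerBlDr; have /= := expR_ge1Dx (ln L.+2%:R - ln L.+1%:R : R).
  rewrite expRD expRN !lnK ?posrE ?ltr0n//.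
  have : L.+2%:R / L.+1%:R = 1 + L.+1%:R^-1 :> R.
    by rewrite -[L.+2]addn1 natrD mulrDl mul1r divff ?pnatr_eq0.
  by move=> ->; rewrite lerD2l.
apply: le_trans (h _); rewrite -ler_expR lnK ?posrE ?ltr0n//.
exact: ltW (truncnS_gt _).
Qed.

(** With powers written as exponentials of logarithms, this compares y^-p with a difference of (1 -
    p)-th powers, so that sums of p-th negative powers telescope. It follows from exp s >= 1 + s and
    ln(y / x) >= 1 - x / y. *)
Lemma power_difference_ge (p x y : R) : 1 < p -> 0 < x -> x <= y ->
  (p - 1) * (y - x) * expR (- p * ln y) <=
  expR (- (p - 1) * ln x) - expR (- (p - 1) * ln y).
Proof.
move=> p1 x0 xy; have y0 : 0 < y by exact: lt_le_trans xy.
have -> : expR (- (p - 1) * ln x) =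
    expR (- (p - 1) * ln y) * expR ((p - 1) * (ln y - ln x)).
  by rewrite -expRD; congr expR; ring.
have -> : expR (- p * ln y) = expR (- (p - 1) * ln y) / y.
  rewrite -[y in _ / y]lnK ?posrE// -expRN -expRD; congr expR; ring.
have h1 : 1 - x / y <= ln y - ln x.
  have := expR_ge1Dx (ln x - ln y).
  by rewrite expRD expRN !lnK ?posrE//; lra.
have h2 := expR_ge1Dx ((p - 1) * (ln y - ln x)).
have h3 : (p - 1) * (1 - x / y) <= (p - 1) * (ln y - ln x).
  by rewrite ler_pM2l// subr_gt0.
have e0 := expR_gt0 (- (p - 1) * ln y).
have -> : (p - 1) * (y - x) * (expR (- (p - 1) * ln y) / y) =
    expR (- (p - 1) * ln y) * ((p - 1) * (1 - x / y)).
  by field; rewrite gt_eqF.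
rewrite -[X in _ <= _ - X]mulr1 -mulrBr ler_pM2l//.
by apply: le_trans h3 _; rewrite lerBrDl.
Qed.

End log_facts.

Section sigma_asymptotics.
Variables (R : realType) (alpha beta c1 c2 : R) (sigma : nat -> R).
Hypothesis alpha_ge0 : 0 <= alpha.
Hypothesis c1_gt0 : 0 < c1.
Hypothesis c2_gt0 : 0 < c2.

(* neglog_rate n = - ln (n^-alpha ln(n+1)^-beta). *)
Definition neglog_rate (n : nat) : R := alpha * ln n%:R + beta * ln (ln n.+1%:R).
Local Notation S := neglog_rate.

Hypothesis sigma_ninc : nonincreasing_seq sigma.
Hypothesis sigma_ge : forall n, (0 < n)%N -> c1 * expR (- S n) <= sigma n.-1.
Hypothesis sigma_le : forall n, (0 < n)%N -> sigma n.-1 <= c2 * expR (- S n).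

Lemma sigma_gt0 k : 0 < sigma k.
Proof.
by apply: lt_le_trans (sigma_ge (isT : (0 < k.+1)%N)); rewrite mulr_gt0 ?expR_gt0.
Qed.

Let bnorm : - `|beta| <= beta <= `|beta|.
Proof. by rewrite -ler_norml. Qed.

(** Between indices within a factor [K] the logarithm grows by at most ln K and, since ln(a + 2) >=
    ln 2, the iterated logarithm by at most a constant. The absolute value of [beta] covers both
    signs. *)
Lemma sigma_comparable (K : nat) : (0 < K)%N -> exists2 D : R, 0 < D &
  forall a b : nat, (a <= b)%N -> (b.+1 <= K * a.+1)%N -> sigma a <= D * sigma b.
Proof.
move=> K0; pose E := alpha * ln K%:R + `|beta| * ln (ln K%:R / ln 2 + 1).
have K1 : 1 <= K%:R :> R by rewrite ler1n.
have lK : 0 <= ln K%:R :> R by exact: ln_ge0.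
have l2 := ln2_gt0 R.
exists (c2 / c1 * expR E); first by rewrite mulr_gt0 ?divr_gt0 ?expR_gt0.
move=> a b ab bK.
apply: le_trans (sigma_le (isT : (0 < a.+1)%N)) _.
have := sigma_ge (isT : (0 < b.+1)%N) => /= sb.
apply: (@le_trans _ _ (c2 / c1 * expR E * (c1 * expR (- S b.+1)))); last first.
  by rewrite ler_wpM2l// ltW// mulr_gt0 ?divr_gt0 ?expR_gt0.
have -> : c2 / c1 * expR E * (c1 * expR (- S b.+1)) = c2 * expR (E - S b.+1).
  by rewrite [expR (E - _)]expRD; move: (expR E) (expR (- S _)) => x y; field; rewrite gt_eqF.
rewrite ler_pM2l// ler_expR.
suff : S b.+1 - S a.+1 <= E by lra.
have h1 : ln b.+1%:R - ln a.+1%:R <= ln K%:R :> R.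
  rewrite lerBlDr -lnM ?posrE ?ltr0n// ler_ln ?posrE ?mulr_gt0 ?ltr0n//.
  by rewrite -natrM ler_nat.
have la : ln 2 <= ln a.+2%:R :> R by apply: ln_natr_ge_ln2.
have la0 : 0 < ln a.+2%:R :> R by exact: lt_le_trans la.
have lab : ln a.+2%:R <= ln b.+2%:R :> R.
  by rewrite ler_ln ?posrE ?ltr0n// ler_nat !ltnS.
have lb0 : 0 < ln b.+2%:R :> R by exact: lt_le_trans lab.
have h2 : ln b.+2%:R <= (ln K%:R / ln 2 + 1) * ln a.+2%:R :> R.
  apply: (@le_trans _ _ (ln K%:R + ln a.+2%:R)).
    rewrite -lnM ?posrE ?ltr0n// ler_ln ?posrE ?mulr_gt0 ?ltr0n//.
    rewrite -natrM ler_nat; apply: (@leq_trans (K * a.+1).+1); first by [].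
    by rewrite [(K * a.+2)%N]mulnS [(K + _)%N]addnC -addn1 leq_add2l.
  rewrite mulrDl mul1r lerD2r -mulrA ler_peMr// mulrC ler_pdivlMr// mul1r//.
have h3 : 0 <= ln (ln b.+2%:R) - ln (ln a.+2%:R) :> R /\
    ln (ln b.+2%:R) - ln (ln a.+2%:R) <= ln (ln K%:R / ln 2 + 1) :> R.
  split; first by rewrite subr_ge0 ler_ln ?posrE.
  have p0 : 0 < ln K%:R / ln 2 + 1 :> R by rewrite ltr_wpDl// divr_ge0// ltW.
  by rewrite lerBlDr -lnM ?posrE// ler_ln ?posrE ?mulr_gt0.
rewrite /neglog_rate /E; move: h3 => [h3 h4].
have -> : alpha * ln b.+1%:R + beta * ln (ln b.+2%:R) - (alpha * ln a.+1%:R + beta * ln (ln a.+2%:R))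
  = alpha * (ln b.+1%:R - ln a.+1%:R) + beta * (ln (ln b.+2%:R) - ln (ln a.+2%:R)) by ring.
apply: lerD; first exact: ler_wpM2l.
move: h3 h4; move: (_ - _) (ln (_ + 1)) => x y x0 xy; case/andP: bnorm => _ bn.
apply: (@le_trans _ _ (`|beta| * x)); first exact: ler_wpM2r.
by rewrite ler_wpM2l.
Qed.

Lemma dyadic_term_le (n l : nat) : (0 < n)%N ->
  2 ^+ l * sigma (n * 2 ^ l)%N ^+ 2 <=
  c2 ^+ 2 * expR (l%:R * ln 2 - 2 * S (n * 2 ^ l)).
Proof.
move=> n0; have nl0 : (0 < n * 2 ^ l)%N by rewrite muln_gt0 n0 expn_gt0.
have h : sigma (n * 2 ^ l)%N <= c2 * expR (- S (n * 2 ^ l)).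
  by apply: le_trans (sigma_le nl0); apply: sigma_ninc; exact: leq_pred.
have -> : expR (l%:R * ln 2 - 2 * S (n * 2 ^ l)) = 2 ^+ l * expR (- S (n * 2 ^ l)) ^+ 2 :> R.
  rewrite expRD expRM_natl lnK ?posrE// -expRM_natl; congr (_ * expR _); ring.
rewrite [leRHS](_ : _ = 2 ^+ l * (c2 * expR (- S (n * 2 ^ l))) ^+ 2); last by ring.
rewrite ler_wpM2l ?exprn_ge0//.
by rewrite lerXn2r ?nnegrE ?mulr_ge0 ?expR_ge0 ?(ltW (sigma_gt0 _)) ?(ltW c2_gt0).
Qed.

Lemma dyadic_sum_mono (K n L : nat) : (0 < K)%N ->
  \sum_(l < L) 2 ^+ l * sigma (K * n * 2 ^ l)%N ^+ 2 <=
  \sum_(l < L) 2 ^+ l * sigma (n * 2 ^ l)%N ^+ 2.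
Proof.
move=> K0; apply: ler_sum => l _; rewrite ler_wpM2l ?exprn_ge0//.
rewrite lerXn2r ?nnegrE ?(ltW (sigma_gt0 _))//; apply: sigma_ninc.
by rewrite -mulnA leq_pmull.
Qed.

(** The index K n 2^(l+1) + 1 of the semiaxis is at most 4 K times n 2^l, the shift by one
    included. *)
Lemma dyadic_term_ge (K : nat) : (0 < K)%N -> exists2 D : R, 0 < D &
  forall n l : nat, (0 < n)%N ->
  D * expR (l%:R * ln 2 - 2 * S (n * 2 ^ l)) <=
  2 ^+ l * sigma (K * n * 2 ^ l.+1)%N ^+ 2.
Proof.
move=> K0; have K2 : (0 < 4 * K)%N by rewrite muln_gt0.
have [D D0 hD] := sigma_comparable K2.
exists ((c1 / D) ^+ 2); first by rewrite exprn_gt0// divr_gt0.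
move=> n l n0; have nl0 : (0 < n * 2 ^ l)%N by rewrite muln_gt0 n0 expn_gt0.
have h : c1 * expR (- S (n * 2 ^ l)) <= D * sigma (K * n * 2 ^ l.+1)%N.
  apply: le_trans (sigma_ge nl0) _; apply: hD.
    apply: leq_trans (leq_pred _) _; rewrite expnS mulnCA -mulnA.
    by rewrite (leq_trans _ (leq_pmull _ _))// leq_pmull.
  rewrite prednK// expnS; move: nl0; move: (2 ^ l)%N => q nq.
  have Knq : (0 < K * (n * q))%N by rewrite muln_gt0 K0.
  by rewrite (_ : K * n * (2 * q) = 2 * (K * (n * q)))%N; lia.
have -> : expR (l%:R * ln 2 - 2 * S (n * 2 ^ l)) = 2 ^+ l * expR (- S (n * 2 ^ l)) ^+ 2 :> R.
  rewrite expRD expRM_natl lnK ?posrE// -expRM_natl; congr (_ * expR _); ring.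
rewrite [leLHS](_ : _ = 2 ^+ l * (c1 / D * expR (- S (n * 2 ^ l))) ^+ 2); last by ring.
rewrite ler_wpM2l ?exprn_ge0//.
rewrite lerXn2r ?nnegrE ?mulr_ge0 ?invr_ge0 ?expR_ge0 ?(ltW (sigma_gt0 _)) ?(ltW c1_gt0) ?(ltW D0)//.
by rewrite mulrAC ler_pdivrMr// [leRHS]mulrC.
Qed.

Lemma sigma_sqr_ge : exists2 D : R, 0 < D & forall n, (0 < n)%N ->
  D * expR (- (2 * S n)) <= sigma n ^+ 2.
Proof.
have [D D0 hD] := sigma_comparable (isT : (0 < 2)%N).
exists ((c1 / D) ^+ 2); first by rewrite exprn_gt0// divr_gt0.
move=> n n0.
have h : c1 * expR (- S n) <= D * sigma n.
  apply: le_trans (sigma_ge n0) _; apply: hD; first exact: leq_pred.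
  by rewrite prednK//; lia.
have -> : expR (- (2 * S n)) = expR (- S n) ^+ 2.
  by rewrite -expRM_natl; congr expR; ring.
rewrite -exprMn.
rewrite lerXn2r ?nnegrE ?mulr_ge0 ?invr_ge0 ?expR_ge0 ?(ltW (sigma_gt0 _)) ?(ltW c1_gt0) ?(ltW D0)//.
by rewrite mulrAC ler_pdivrMr// [leRHS]mulrC.
Qed.

(** This absorbs the failure probability of the block estimates into the rate. *)
Lemma sigma_ge_exp (del : R) : 0 < del -> exists2 C : R, 0 < C &
  forall n, expR (- del * n%:R) <= C * sigma n.
Proof.
move=> del0; pose g := alpha + `|beta| + 1.
have g0 : 0 < g by rewrite /g ltr_pwDr// addr_ge0.
have [C hC] := ln_le_linear (divr_gt0 del0 g0).
have l2 := ln2_gt0 R.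
pose E := del * 2 + g * C + `|beta| * `|ln (ln 2)|.
exists (c1^-1 * expR E); first by rewrite mulr_gt0 ?invr_gt0 ?expR_gt0.
move=> n; have := sigma_ge (isT : (0 < n.+1)%N) => /= sn.
apply: (@le_trans _ _ (c1^-1 * expR E * (c1 * expR (- S n.+1)))); last first.
  by rewrite ler_wpM2l// ltW// mulr_gt0 ?invr_gt0 ?expR_gt0.
have -> : c1^-1 * expR E * (c1 * expR (- S n.+1)) = expR (E - S n.+1).
  by rewrite [expR (E - _)]expRD; move: (expR E) (expR (- S _)) => x y; field; rewrite gt_eqF.
rewrite ler_expR.
pose x : R := ln n.+2%:R.
have x2 : ln 2 <= x by apply: ln_natr_ge_ln2.
have x0 : 0 < x by exact: lt_le_trans x2.
have xC : g * x <= del * n%:R + del * 2 + g * C.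
  have := hC n.+2%:R; rewrite ltr0n => /(_ isT); rewrite -/x => h.
  have : g * x <= g * (del / g * n.+2%:R + C) by rewrite ler_pM2l.
  rewrite mulrDr mulrA mulrCA divff ?gt_eqF// mulr1 -addn2 natrD mulrDr.
  done.
have h1 : alpha * ln n.+1%:R <= alpha * x.
  by rewrite ler_wpM2l// ler_ln ?posrE ?ltr0n// ler_nat.
have h2 : beta * ln x <= `|beta| * x + `|beta| * `|ln (ln 2)|.
  rewrite -mulrDr; apply: le_trans (ler_norm _) _; rewrite normrM ler_wpM2l//.
  rewrite ler_norml; apply/andP; split.
    have : ln (ln 2) <= ln x by rewrite ler_ln ?posrE.
    by have := ler_norm (- ln (ln 2 : R)); rewrite normrN; lra.
  have := expR_ge1Dx (ln x); rewrite lnK ?posrE//.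
  by have := normr_ge0 (ln (ln 2 : R)); lra.
rewrite /neglog_rate -/x mulNr /E.
have : g * x = alpha * x + `|beta| * x + x by rewrite /g; ring.
by lra.
Qed.

(** [e] is the increase of the iterated logarithm. Its bound is independent of [n], which keeps
    later constants uniform; it is not merged with [beta], whose sign is open. *)
Lemma neglog_dyadic (n l : nat) : (0 < n)%N -> exists2 e : R,
  S (n * 2 ^ l) = S n + alpha * (l%:R * ln 2) + beta * e & 0 <= e <= ln l.+1%:R.
Proof.
move=> n0; have a0 := ln_natr_gt0 R n0.
have nl0 : (0 < n * 2 ^ l)%N by rewrite muln_gt0 n0 expn_gt0.
have b0 := ln_natr_gt0 R nl0.
exists (ln (ln (n * 2 ^ l).+1%:R) - ln (ln n.+1%:R)).
  rewrite /neglog_rate natrM natrX lnM ?posrE ?ltr0n ?exprn_gt0//.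
  by rewrite lnXn// -[ln 2 *+ l]mulr_natl; ring.
apply/andP; split; first by rewrite subr_ge0 ler_ln ?posrE//; exact: ln_dyadic_ge.
rewrite lerBlDr -lnM ?posrE ?ltr0n// ler_ln ?posrE ?mulr_gt0 ?ltr0n//.
exact: ln_dyadic_le.
Qed.

(** Up to constants the l-th term is at most sigma_(n+1)^2 times 2^(-(2 alpha - 1) l) (l + 1)^(2
    |beta|). Half of the exponential decay absorbs the power of l + 1, the other half leaves a
    geometric series. *)
Lemma dyadic_sum_le_polynomial : 2^-1 < alpha -> exists2 C : R, 0 < C &
  forall n L : nat, (0 < n)%N ->
  \sum_(l < L) 2 ^+ l * sigma (n * 2 ^ l)%N ^+ 2 <= C * sigma n ^+ 2.
Proof.
move=> ha; have [D D0 hD] := sigma_sqr_ge; have l2 := ln2_gt0 R.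
pose e : R := (2 * alpha - 1) * ln 2.
have e0 : 0 < e by rewrite mulr_gt0//; lra.
pose g := 2 * `|beta| + 1.
have g0 : 0 < g by rewrite /g; have := normr_ge0 beta; lra.
have [C hC] := ln_le_linear (divr_gt0 (divr_gt0 e0 (ltr0n R 2)) g0).
have [C' C'E] : exists C', C' = e / 2 + g * `|C| by eexists.
have r1 : expR (- (e / 2)) < 1 by rewrite -expR0 ltr_expR oppr_lt0 divr_gt0.
have q0 : 0 < (1 - expR (- (e / 2)))^-1 by rewrite invr_gt0 subr_gt0.
exists (c2 ^+ 2 * expR C' * (1 - expR (- (e / 2)))^-1 / D).
  by rewrite divr_gt0// mulr_gt0// mulr_gt0 ?exprn_gt0 ?expR_gt0.
move=> n L n0.
have tl l : 2 ^+ l * sigma (n * 2 ^ l)%N ^+ 2 <=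
    c2 ^+ 2 * expR C' * (sigma n ^+ 2 / D) * expR (- (e / 2) * l%:R).
  apply: le_trans (dyadic_term_le l n0) _.
  apply: (@le_trans _ _ (c2 ^+ 2 * expR C' * expR (- (2 * S n)) * expR (- (e / 2) * l%:R))).
    rewrite [leRHS](_ : _ = c2 ^+ 2 * expR (C' - 2 * S n + - (e / 2) * l%:R)); last first.
      by rewrite !expRD !mulrA.
    rewrite ler_pM2l ?exprn_gt0// ler_expR.
    have [d -> /andP[d0 dl]] := neglog_dyadic l n0.
    have := hC l.+1%:R; rewrite ltr0n => /(_ isT) hl.
    have : g * ln l.+1%:R <= e / 2 * l.+1%:R + g * `|C|.
      apply: (@le_trans _ _ (g * (e / 2 / g * l.+1%:R + C))); first by rewrite ler_pM2l.
      rewrite mulrDr; apply: lerD; last by rewrite ler_pM2l// ler_norm.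
      by rewrite mulrA [g * _]mulrC divfK// gt_eqF.
    rewrite -[X in e / 2 * X%:R]addn1 natrD mulrDr mulr1.
    have : - (2 * (beta * d)) <= g * ln l.+1%:R.
      apply: (@le_trans _ _ (2 * `|beta| * d)).
        have := ler_wpM2r d0 (ler_norm (- beta)); rewrite normrN; lra.
      have ll : 0 <= ln l.+1%:R :> R by exact: le_trans dl.
      apply: (@le_trans _ _ (2 * `|beta| * ln l.+1%:R)).
        by rewrite ler_wpM2l// mulr_ge0.
      by rewrite ler_wpM2r// /g; lra.
    have : e / 2 * l%:R = alpha * (l%:R * ln 2) - l%:R * ln 2 / 2 by rewrite /e; field.
    rewrite C'E mulNr.
    move: (alpha * (l%:R * ln 2)) => x1; move: (l%:R * ln 2) => x2.
    move: (e / 2 * l%:R) (e / 2) (g * ln _) (g * `|C|) (beta * d) => *; lra.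
  rewrite ler_wpM2r ?expR_ge0// ler_pM2l ?mulr_gt0 ?exprn_gt0 ?expR_gt0//.
  by rewrite ler_pdivlMr// mulrC hD.
apply: (@le_trans _ _ (\sum_(l < L) c2 ^+ 2 * expR C' * (sigma n ^+ 2 / D) * expR (- (e / 2) * l%:R))).
  by apply: ler_sum => l _.
rewrite -mulr_sumr.
have -> : c2 ^+ 2 * expR C' / (1 - expR (- (e / 2))) / D * sigma n ^+ 2 =
  c2 ^+ 2 * expR C' * (sigma n ^+ 2 / D) * (1 - expR (- (e / 2)))^-1 by ring.
rewrite ler_wpM2l ?sum_exp_geometric_le ?divr_gt0//.
by apply: mulr_ge0; apply: mulr_ge0; rewrite ?sqr_ge0 ?expR_ge0 ?invr_ge0 ?(ltW D0).
Qed.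

Section critical.
Hypothesis alphaE : alpha = 2^-1.
Hypothesis beta_gt : 2^-1 < beta.

Let p := 2 * beta.

Let p_gt1 : 1 < p. Proof. by have := beta_gt; rewrite /p; lra. Qed.

(** At the exponent 1/2 the factor 2^l cancels exactly: the l-th term has order n^-1 ln(n 2^l +
    1)^-p. *)
Lemma neglog_critical (n l : nat) : (0 < n)%N ->
  l%:R * ln 2 - 2 * S (n * 2 ^ l) = - ln n%:R + - p * ln (ln (n * 2 ^ l).+1%:R).
Proof.
move=> n0; rewrite /neglog_rate natrM natrX lnM ?posrE ?ltr0n ?exprn_gt0//.
by rewrite lnXn// -[ln 2 *+ l]mulr_natl alphaE /p; field.
Qed.

(* With x_l = ln(n+1) + l ln 2, the l-th term is at most a multiple of
   n^-1 x_l^-p, and x_l^-p is controlled by x_l^(1-p) - x_(l+1)^(1-p). *)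
Lemma dyadic_sum_le_critical : exists2 C : R, 0 < C & forall n L : nat, (0 < n)%N ->
  \sum_(l < L) 2 ^+ l * sigma (n * 2 ^ l)%N ^+ 2 <= C * (sigma n ^+ 2 * ln n.+1%:R).
Proof.
have [D D0 hD] := sigma_sqr_ge; have l2 := ln2_gt0 R.
(* One factor 2^p comes from ln(n 2^l + 1) >= x_l / 2, the other from x_(l+1) <= 2 x_l; the
   denominator comes from [power_difference_ge] with step ln 2. *)
pose kap := expR (p * ln 2) * expR (p * ln 2) / ((p - 1) * ln 2).
have pb : 0 < (p - 1) * ln 2 by rewrite mulr_gt0// subr_gt0.
have kap0 : 0 < kap by rewrite divr_gt0// mulr_gt0 ?expR_gt0.
exists (c2 ^+ 2 * kap / D); first by rewrite divr_gt0// mulr_gt0 ?exprn_gt0.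
move=> n L n0; set a : R := ln n.+1%:R.
have a0 : 0 < a by exact: ln_natr_gt0.
have a2 : ln 2 <= a by exact: ln_natr_ge_ln2.
pose x (l : nat) : R := a + l%:R * ln 2.
have x0 l : 0 < x l by rewrite ltr_pwDl// mulr_ge0// ltW.
have xS l : x l.+1 = x l + ln 2 by rewrite /x -addn1 natrD mulrDl mul1r addrA.
have xge l : ln 2 <= x l by rewrite (le_trans a2)// lerDl mulr_ge0// ltW.
pose F (y : R) := expR (- (p - 1) * ln y).
have term l : expR (- p * ln (ln (n * 2 ^ l).+1%:R)) <= kap * (F (x l) - F (x l.+1)).
  have yl : ln (x l / 2) <= ln (ln (n * 2 ^ l).+1%:R).
    have n20 : 0 < ln (n * 2 ^ l).+1%:R :> R.
      by apply: ln_natr_gt0; rewrite muln_gt0 n0 expn_gt0.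
    rewrite ler_ln ?posrE ?divr_gt0//.
    have h1 : a <= ln (n * 2 ^ l).+1%:R by exact: ln_dyadic_ge.
    have h2 : l%:R * ln 2 <= ln (n * 2 ^ l).+1%:R :> R.
      rewrite mulr_natl -lnXn// ler_ln ?posrE ?exprn_gt0 ?ltr0n//.
      by rewrite -natrX ler_nat ltnW// ltnS leq_pmull.
    by rewrite /x; lra.
  have xl2 : ln (x l.+1) <= ln (x l) + ln 2.
    rewrite -lnM ?posrE// ler_ln ?posrE ?mulr_gt0// xS.
    by have := xge l; lra.
  have xSle : x l <= x l.+1 by rewrite xS lerDl ltW.
  have := power_difference_ge p_gt1 (x0 l) xSle.
  rewrite -/(F (x l)) -/(F (x l.+1)) [x l.+1 - _](_ : _ = ln 2); last by rewrite xS; ring.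
  move=> h; apply: (@le_trans _ _ (kap * ((p - 1) * ln 2 * expR (- p * ln (x l.+1))))); last first.
    by rewrite ler_pM2l.
  have -> : kap * ((p - 1) * ln 2 * expR (- p * ln (x l.+1))) =
      expR (p * ln 2) * expR (p * ln 2) * expR (- p * ln (x l.+1)).
    by rewrite /kap; move: (expR _) (expR _) => u v; field; rewrite gt_eqF// gt_eqF// subr_gt0.
  rewrite -!expRD ler_expR.
  rewrite lnM ?posrE ?invr_gt0// lnV ?posrE// in yl.
  have p0 : 0 < p by exact: lt_trans p_gt1.
  have q1 : p * (ln (x l) + - ln 2) <= p * ln (ln (n * 2 ^ l).+1%:R) by rewrite ler_pM2l.
  have q2 : p * ln (x l.+1) <= p * (ln (x l) + ln 2) by rewrite ler_pM2l.
  by move: q1 q2; rewrite !mulrDr !mulNr mulrN; lra.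
have tele M : \sum_(l < M) expR (- p * ln (ln (n * 2 ^ l).+1%:R)) <= kap * (F (x 0%N) - F (x M)).
  elim: M => [|M IH]; first by rewrite big_ord0 subrr mulr0.
  rewrite big_ord_recr/=; apply: le_trans (lerD IH (term M)) _.
  by rewrite -mulrDr ler_pM2l//; lra.
have Fa : expR (- ln n%:R) * F (x 0%N) <= sigma n ^+ 2 / D * a.
  have -> : F (x 0%N) = a * expR (- p * ln a).
    rewrite /F /x mul0r addr0 -{2}[a]lnK ?posrE// -expRD; congr expR; ring.
  rewrite mulrCA -expRD.
  have -> : - ln n%:R + - p * ln a = - (2 * S n).
    by rewrite /neglog_rate alphaE /p -/a; field.
  by rewrite mulrC ler_pM2r// ler_pdivlMr// mulrC hD.
apply: (@le_trans _ _ (c2 ^+ 2 * (expR (- ln n%:R) * \sum_(l < L) expR (- p * ln (ln (n * 2 ^ l).+1%:R))))).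
  rewrite !mulr_sumr; apply: ler_sum => l _.
  by apply: le_trans (dyadic_term_le l n0) _; rewrite neglog_critical// expRD.
have -> : c2 ^+ 2 * kap / D * (sigma n ^+ 2 * a) = c2 ^+ 2 * (kap * (sigma n ^+ 2 / D * a)) by ring.
rewrite ler_pM2l ?exprn_gt0//.
apply: (@le_trans _ _ (expR (- ln n%:R) * (kap * F (x 0%N)))).
  rewrite ler_pM2l ?expR_gt0//; apply: le_trans (tele L) _.
  by rewrite ler_pM2l// gerBl expR_ge0.
by rewrite mulrCA ler_pM2l.
Qed.

(** While 2^l <= n + 1, ln(n 2^l + 1) is at most 2 ln(n + 1), so each such term is at least a
    constant times sigma_(n+1)^2; there are at least ln(n + 1) / ln 2 of them. *)
Lemma dyadic_sum_ge_critical (K : nat) : (0 < K)%N -> exists2 c : R, 0 < c &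
  forall n : nat, (0 < n)%N -> exists L,
  c * (sigma n ^+ 2 * ln n.+1%:R) <= \sum_(l < L) 2 ^+ l * sigma (K * n * 2 ^ l.+1)%N ^+ 2.
Proof.
move=> K0; have [D D0 hD] := dyadic_term_ge K0; have l2 := ln2_gt0 R.
exists (D * expR (- p * ln 2) / (c2 ^+ 2 * ln 2)).
  by rewrite divr_gt0 ?mulr_gt0 ?exprn_gt0 ?expR_gt0.
move=> n n0; pose L := (trunc_log 2 n.+1).+1; exists L.
set a : R := ln n.+1%:R; have a0 : 0 < a by exact: ln_natr_gt0.
have aL : a <= L%:R * ln 2.
  rewrite mulr_natl -lnXn// ler_ln ?posrE ?exprn_gt0 ?ltr0n//.
  by rewrite -natrX ler_nat ltnW// trunc_log_ltn.
have p0 : 0 < p by exact: lt_trans p_gt1.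
have term (l : 'I_L) : D * (expR (- p * ln 2) * expR (- (2 * S n))) <=
    2 ^+ l * sigma (K * n * 2 ^ l.+1)%N ^+ 2.
  apply: le_trans (hD n l n0); rewrite ler_pM2l// -expRD ler_expR neglog_critical//.
  have y0 : 0 < ln (n * 2 ^ l).+1%:R :> R.
    by apply: ln_natr_gt0; rewrite muln_gt0 n0 expn_gt0.
  have h : ln (ln (n * 2 ^ l).+1%:R) <= ln 2 + ln a.
    rewrite -lnM ?posrE// ler_ln ?posrE ?mulr_gt0// mulr_natl -lnXn ?ltr0n//.
    rewrite ler_ln ?posrE ?exprn_gt0 ?ltr0n// -natrX ler_nat.
    have : (2 ^ l <= n.+1)%N.
      apply: leq_trans (trunc_logP (isT : (1 < 2)%N) (isT : (0 < n.+1)%N)).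
      by rewrite leq_exp2l// -ltnS.
    move: (2 ^ l)%N => q qn; rewrite expnS expn1 mulSn -addn1 addnC.
    by rewrite leq_add// leq_mul2l qn orbT.
  have := h; rewrite -(ler_pM2l p0) mulrDr /neglog_rate alphaE /p -/a => h'.
  by move: h'; rewrite !mulNr; lra.
have sn : sigma n ^+ 2 <= c2 ^+ 2 * expR (- (2 * S n)).
  have -> : expR (- (2 * S n)) = expR (- S n) ^+ 2.
    by rewrite -expRM_natl; congr expR; ring.
  rewrite -exprMn lerXn2r ?nnegrE ?mulr_ge0 ?expR_ge0 ?(ltW (sigma_gt0 _)) ?(ltW c2_gt0)//.
  by apply: le_trans (sigma_le n0); apply: sigma_ninc; exact: leq_pred.
apply: (@le_trans _ _ (\sum_(l < L) D * (expR (- p * ln 2) * expR (- (2 * S n))))); last first.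
  by apply: ler_sum => l _.
rewrite sumr_const card_ord -[leRHS]mulr_natl.
apply: (@le_trans _ _ (D * expR (- p * ln 2) / (c2 ^+ 2 * ln 2) *
    ((c2 ^+ 2 * expR (- (2 * S n))) * (L%:R * ln 2)))).
  rewrite ler_wpM2l//.
    by rewrite divr_ge0 ?mulr_ge0 ?expR_ge0 ?exprn_ge0 ?(ltW D0) ?(ltW c2_gt0) ?(ltW l2).
  by apply: ler_pM => //; [exact: sqr_ge0|exact: ltW].
rewrite le_eqVlt; apply/orP; left; apply/eqP.
by move: (expR _) (expR _) (L%:R) => u v w; field; rewrite !gt_eqF.
Qed.

(** The product is at most a constant times n^-1 ln(n + 1)^(1 - p), with p > 1. This keeps the first
    coordinate of the kernel vector within a multiple of sigma_1. *)
Lemma sigma_sqr_ln_bounded : exists2 Y : R, 0 < Y & forall n, (0 < n)%N ->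
  sigma n ^+ 2 * ln n.+1%:R <= Y.
Proof.
exists (c2 ^+ 2 * expR (- (p - 1) * ln (ln 2))).
  by rewrite mulr_gt0 ?exprn_gt0 ?expR_gt0.
move=> n n0; set a : R := ln n.+1%:R; have a0 : 0 < a by exact: ln_natr_gt0.
have sn : sigma n ^+ 2 <= c2 ^+ 2 * expR (- (2 * S n)).
  have -> : expR (- (2 * S n)) = expR (- S n) ^+ 2.
    by rewrite -expRM_natl; congr expR; ring.
  rewrite -exprMn lerXn2r ?nnegrE ?mulr_ge0 ?expR_ge0 ?(ltW (sigma_gt0 _)) ?(ltW c2_gt0)//.
  by apply: le_trans (sigma_le n0); apply: sigma_ninc; exact: leq_pred.
apply: (@le_trans _ _ (c2 ^+ 2 * expR (- (2 * S n)) * a)); first by rewrite ler_wpM2r// ltW.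
rewrite -mulrA ler_pM2l ?exprn_gt0// -[X in _ * X]lnK ?posrE// -expRD ler_expR.
have -> : - (2 * S n) = - ln n%:R - p * ln a.
  by rewrite /neglog_rate alphaE /p -/a; field.
have l0 : 0 <= ln n%:R :> R by apply: ln_ge0; rewrite ler1n.
have : (p - 1) * ln (ln 2) <= (p - 1) * ln a.
  rewrite ler_pM2l ?subr_gt0// ler_ln ?posrE ?ln2_gt0//; exact: ln_natr_ge_ln2.
by rewrite mulNr [X in _ <= X -> _]mulrBl mul1r; lra.
Qed.

End critical.

(** In both cases the l-th term is at least c / (l + 1) with c > 0 depending on [n], and the
    harmonic series diverges. For alpha < 1/2 the exponential growth pays for the logarithmic
    factor. *)
Lemma dyadic_sum_unbounded (K n : nat) (B : R) : (0 < K)%N -> (0 < n)%N ->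
  alpha < 2^-1 \/ (beta <= alpha /\ alpha = 2^-1) ->
  exists L, B <= \sum_(l < L) 2 ^+ l * sigma (K * n * 2 ^ l.+1)%N ^+ 2.
Proof.
move=> K0 n0 hab; have [D D0 hD] := dyadic_term_ge K0; have l2 := ln2_gt0 R.
have [C hC] : exists C : R, forall l : nat,
    - ln l.+1%:R - C <= l%:R * ln 2 - 2 * S (n * 2 ^ l).
  case: hab => [ha|[ba aE]]; last first.
    exists (2 * S n) => l; have [d -> /andP[d0 dl]] := neglog_dyadic l n0.
    rewrite aE; suff : 2 * (beta * d) <= ln l.+1%:R by lra.
    by apply: le_trans dl; nra.
  pose e : R := (1 - 2 * alpha) * ln 2.
  have e0 : 0 < e by rewrite mulr_gt0//; lra.
  pose g := 2 * `|beta| + 1.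
  have g0 : 0 < g by rewrite /g; have := normr_ge0 beta; lra.
  have [C hC] := ln_le_linear (divr_gt0 e0 g0).
  exists (2 * S n + e + g * `|C|) => l; have [d -> /andP[d0 dl]] := neglog_dyadic l n0.
  have ll : 0 <= ln l.+1%:R :> R by exact: le_trans dl.
  have := hC l.+1%:R; rewrite ltr0n => /(_ isT) hl.
  have : g * ln l.+1%:R <= e * l.+1%:R + g * `|C|.
    apply: (@le_trans _ _ (g * (e / g * l.+1%:R + C))); first by rewrite ler_pM2l.
    rewrite mulrDr; apply: lerD; last by rewrite ler_pM2l// ler_norm.
    by rewrite mulrA [g * _]mulrC divfK// gt_eqF.
  rewrite -[X in e * X%:R]addn1 natrD.
  have : 2 * (beta * d) <= g * ln l.+1%:R.
    apply: (@le_trans _ _ (2 * `|beta| * d)).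
      have := ler_wpM2r d0 (ler_norm beta); lra.
    apply: (@le_trans _ _ (2 * `|beta| * ln l.+1%:R)).
      by rewrite ler_wpM2l// mulr_ge0.
    by rewrite ler_wpM2r// /g; lra.
  have : e * l%:R = l%:R * ln 2 - 2 * (alpha * (l%:R * ln 2)) by rewrite /e; ring.
  rewrite mulrDr mulr1.
  move: (alpha * (l%:R * ln 2)) => x1; move: (l%:R * ln 2) => x2.
  move: (e * l%:R) (g * ln _) (g * `|C|) (beta * d) => x3 x4 x5 x6.
  by move: (ln l.+1%:R) ll => *; lra.
have [L hL] := harmonic_unbounded (B / (D * expR (- C))).
have p0 : 0 < D * expR (- C) by rewrite mulr_gt0 ?expR_gt0.
exists L; move: hL; rewrite ler_pdivrMr// => /le_trans; apply.
rewrite mulr_suml; apply: ler_sum => l _.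
apply: le_trans (hD n l n0); rewrite mulrCA ler_pM2l//.
rewrite -[l.+1%:R]lnK ?posrE ?ltr0n// -expRN -expRD ler_expR.
by have := hC l; lra.
Qed.

End sigma_asymptotics.

(** * The expected radius *)

(* Neither function need be measurable: the integral of a nonnegative function
   is a supremum over the simple functions below it. *)
Lemma ge0_le_lower_integral d (T : measurableType d) (R : realType)
    (mu : {measure set T -> \bar R}) (f h : T -> \bar R) :
  (forall x, (0 <= f x)%E) -> (forall x, (f x <= h x)%E) ->
  (\int[mu]_x f x <= \int[mu]_x h x)%E.
Proof.
move=> f0 fh; have h0 x : (0 <= h x)%E by exact: le_trans (f0 x) (fh x).
rewrite !ge0_integralTE//; apply: ereal_sup_le => _ [s sf <-].
by exists s => // x; exact: le_trans (sf x) (fh x).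
Qed.

Lemma prob_bigcup_le d (T : measurableType d) (R : realType) (P : probability T R)
    (B : nat -> set T) (b : nat -> R) (C : R) :
  (forall l, measurable (B l)) -> (forall l, 0 <= b l) ->
  (forall l, (P (B l) <= (b l)%:E)%E) -> (forall M, \sum_(0 <= l < M) b l <= C) ->
  (P (\bigcup_l B l) <= C%:E)%E.
Proof.
move=> mB b0 Bb bC.
apply: (@le_trans _ _ (\sum_(0 <= l <oo) P (B l))%E).
  by apply: measure_sigma_subadditive => //; exact: bigcup_measurable.
apply: (@le_trans _ _ (\sum_(0 <= l <oo) (b l)%:E)%E).
  by apply: lee_nneseries => // l _ _; exact: measure_ge0.
exact/nneseries_le_partial.
Qed.

(** The head block has its own event: its long side is only [n], so its probability bound need not
    be below 1/2 for small [n], while the lower bound for the radius uses the column estimates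
    alone. *)
Lemma gaussian_blocks (R : realType) : exists (c C del : R) (K : nat),
  [/\ 0 < c, 0 < C, 0 < del, (0 < K)%N &
  forall d (T : measurableType d) (P : probability T R) (n : nat)
    (g : 'I_n -> nat -> {RV P >-> R}), (0 < n)%N -> gaussian_matrix g ->
  (exists Bad : set T, [/\ measurable Bad,
    (P Bad <= (6 * expR (- del * n%:R))%:E)%E, (P Bad <= 2^-1%:E)%E &
    forall w, ~ Bad w ->
    (forall v : 'I_n -> R, \sum_(0 <= j < K * n) (\sum_i v i * g i j w) ^+ 2 <=
       C * (K * n)%:R * \sum_i v i ^+ 2) /\
    (forall l (v : 'I_n -> R),
       c * (K * n * 2 ^ l)%:R * \sum_i v i ^+ 2 <=
       \sum_(K * n * 2 ^ l <= j < K * n * 2 ^ l + K * n * 2 ^ l)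
         (\sum_i v i * g i j w) ^+ 2 <=
       C * (K * n * 2 ^ l)%:R * \sum_i v i ^+ 2)]) /\
  (exists Bad : set T, [/\ measurable Bad,
    (P Bad <= (2 * expR (- del * n%:R))%:E)%E &
    forall w, ~ Bad w -> forall v : 'I_(n %/ K) -> R,
      c * n%:R * \sum_j v j ^+ 2 <= \sum_i (\sum_j v j * g i j w) ^+ 2])].
Proof.
have [c [C [del [K0 [c0 C0 del0 K00 H]]]]] := gaussian_block_bounds R.
(* Then E = exp(- del K n) <= 1/16 for every n >= 1. Block l fails with probability at most 2
   E^(2^l) <= 2 E 2^-l, in total 4 E; the first K n columns add 2 E, and 6 E <= 1/2. *)
have [K [K1 KK0 K16]] : exists K : nat, [/\ (0 < K)%N, (K0 <= K)%N & expR (- del * K%:R) <= 16^-1].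
  pose K := maxn K0 (Num.trunc (16 / del)).+1.
  exists K; split; [by rewrite leq_max K00|exact: leq_maxl|].
  rewrite mulNr expRN lef_pV2 ?posrE ?expR_gt0//.
  apply: le_trans (expR_ge1Dx _).
  have : 16 / del <= K%:R.
    by apply: le_trans (ltW (truncnS_gt _)) _; rewrite ler_nat leq_maxr.
  by rewrite ler_pdivrMr// [del * _]mulrC; lra.
exists c, C, del, K; split=> // d T P n g n0 hg.
have n1 : 1 <= n%:R :> R by rewrite ler1n.
have e0 (x : R) := expR_gt0 x.
split; last first.
  have kn : (K0 * (n %/ K) <= n)%N.
    by apply: leq_trans (leq_trunc_div n K); rewrite mulnC leq_mul2l KK0 orbT.
  have [Bad [mB PB hB]] := H _ T P (n %/ K)%N n (fun j i => (g i j : T -> R))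
    (fun j i => @measurable_funP _ _ _ _ _ (g i j)) (gaussian_rows_mgf hg (k := n %/ K)) kn.
  by exists Bad; split=> // w /hB h v; have /andP[] := h v.
have col s q : (K * n <= q)%N -> exists Bad : set T, [/\ measurable Bad,
    (P Bad <= (2 * expR (- del * q%:R))%:E)%E & forall w, ~ Bad w -> forall v : 'I_n -> R,
    c * q%:R * \sum_i v i ^+ 2 <= \sum_(s <= j < s + q) (\sum_i v i * g i j w) ^+ 2
         <= C * q%:R * \sum_i v i ^+ 2].
  move=> Kq; have Kq' : (K0 * n <= q)%N by apply: leq_trans Kq; rewrite leq_mul2r KK0 orbT.
  have [Bad [mB PB hB]] := H _ T P n q (fun i j => (g i (s + j)%N : T -> R))
    (fun i j => @measurable_funP _ _ _ _ _ (g i (s + j)%N)) (gaussian_columns_mgf hg s (q := q)) Kq'.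
  exists Bad; split=> // w /hB h v.
  by have := h v; rewrite colform_columns.
have [B0 [mB0 PB0 hB0]] := col 0%N (K * n)%N (leqnn _).
have Kl l : (K * n <= K * n * 2 ^ l)%N by rewrite leq_pmulr// expn_gt0.
have [B hB] := choice (fun l => col (K * n * 2 ^ l)%N (K * n * 2 ^ l)%N (Kl l)).
pose E := expR (- del * (K * n)%:R).
have E0 : 0 < E by exact: e0.
have E16 : E <= 16^-1.
  apply: le_trans K16; rewrite ler_expR !mulNr lerN2 ler_pM2l// ler_nat.
  by rewrite leq_pmulr.
have PU : (P (\bigcup_l B l) <= (4 * E)%:E)%E.
  apply: (prob_bigcup_le (b := fun l => 2 * E * 2^-1 ^+ l)).
  - by move=> l; case: (hB l).
  - by move=> l; rewrite !mulr_ge0 ?exprn_ge0 ?expR_ge0.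
  - move=> l; have [_ + _] := hB l; move=> /le_trans; apply; rewrite lee_fin -mulrA ler_pM2l//.
    apply: (@le_trans _ _ (E * E ^+ l)).
      rewrite -exprS -expRM_natl ler_expR mulrCA !mulNr lerN2 ler_pM2l// -natrM ler_nat.
      by rewrite mulnC leq_mul2l; apply/orP; right; exact: ltn_expl.
    rewrite ler_pM2l// lerXn2r ?nnegrE ?(ltW E0)//.
    by apply: le_trans E16 _; lra.
  - move=> M; rewrite -mulr_sumr big_mkord.
    have := geometric_half_le2 R M; rewrite -(ler_pM2l (_ : 0 < 2 * E)) ?mulr_gt0//.
    by move=> /le_trans; apply; rewrite mulrAC -natrM.
have mU : measurable (\bigcup_l B l) by apply: bigcup_measurable => l _; case: (hB l).
have P6 : (P (B0 `|` \bigcup_l B l) <= (6 * E)%:E)%E.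
  apply: le_trans (measureU2 _ mB0 mU) _; apply: le_trans (leeD PB0 PU) _.
  by rewrite -EFinD lee_fin /E; lra.
exists (B0 `|` \bigcup_l B l); split.
- exact: measurableU.
- apply: le_trans P6 _; rewrite lee_fin ler_pM2l// ler_expR !mulNr lerN2 ler_pM2l// ler_nat.
  by rewrite leq_pmull.
- by apply: le_trans P6 _; rewrite lee_fin; lra.
- move=> w bw; split=> [v|l v].
    have /hB0 h : ~ B0 w by move=> b; apply: bw; left.
    by have /andP[_] := h v; rewrite add0n.
  have [_ _ h] := hB l; apply: h => b; apply: bw; right; by exists l.
Qed.

Section expectation.
Context d (T : measurableType d) (R : realType) (P : probability T R).
Variables (sigma : nat -> R).
Hypothesis sigma_gt0 : forall k, 0 < sigma k.
Hypothesis sigma_ninc : nonincreasing_seq sigma.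
Variables (n : nat) (g : 'I_n -> nat -> {RV P >-> R}).

Lemma expected_radius_le (A : set T) (B : R) : measurable A -> 0 <= B ->
  (forall w, ~ A w ->
     (radius_of_information sigma (fun i j => g i j w) <= B%:E)%E) ->
  (expected_radius sigma g <= B%:E + (sigma 0%N)%:E * P A)%E.
Proof.
move=> mA B0 hB.
apply: (@le_trans _ _ (\int[P]_w (B%:E + (sigma 0%N)%:E * (\1_A w)%:E))%E).
  apply: ge0_le_lower_integral => w; first exact: radius_ge0.
  have [wA|wA] := pselect (A w); rewrite indicE ?(mem_set wA) ?(memNset wA).
    rewrite mule1; apply: le_trans (radius_le_first sigma_gt0 sigma_ninc _) _.
    by rewrite -EFinD lee_fin lerDr.
  by rewrite mule0 adde0; exact: hB.
have s0 : 0 <= sigma 0%N by exact: ltW.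
rewrite ge0_integralD//; last 2 first.
- by move=> w _; rewrite mule_ge0 ?lee_fin.
- by apply: emeasurable_funM => //; apply/measurable_EFinP.
rewrite [X in (X + _ <= _)%E](_ : _ = B%:E); last first.
  by rewrite integral_cst// [X in (_ * X)%E]probability_setT mule1.
rewrite ge0_integralZl_EFin//.
- by rewrite integral_indic// setIT.
- by apply/measurable_EFinP.
Qed.

Lemma expected_radius_ge (A : set T) (t : R) : measurable A -> 0 <= t ->
  (P A <= 2^-1%:E)%E ->
  (forall w, ~ A w ->
     (t%:E <= radius_of_information sigma (fun i j => g i j w))%E) ->
  ((t / 2)%:E <= expected_radius sigma g)%E.
Proof.
move=> mA t0 PA ht.
apply: (@le_trans _ _ (\int[P]_w (t%:E * (\1_(~` A) w)%:E))%E); last first.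
  apply: ge0_le_lower_integral => w; first by rewrite mule_ge0 ?lee_fin.
  have [wA|wA] := pselect ((~` A) w); rewrite indicE ?(mem_set wA) ?(memNset wA).
    by rewrite mule1; exact: ht.
  by rewrite mule0 radius_ge0.
have mC : measurable (~` A) by exact: measurableC.
rewrite ge0_integralZl_EFin//; last by apply/measurable_EFinP.
rewrite integral_indic// setIT [X in (_ * X)%E](_ : _ = 1 - P A)%E; last exact: probability_setC.
rewrite EFinM.
apply: lee_wpmul2l; first by rewrite lee_fin.
have fA : P A \is a fin_num by exact: fin_num_measure.
move: PA; rewrite -(fineK fA) -EFinB !lee_fin; lra.
Qed.

End expectation.

Section radius_asymptotics.
Variables (R : realType) (alpha beta c1 c2 : R) (sigma : nat -> R).
Hypothesis alpha_ge0 : 0 <= alpha.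
Hypothesis c1_gt0 : 0 < c1.
Hypothesis c2_gt0 : 0 < c2.
Hypothesis sigma_ninc : nonincreasing_seq sigma.
Hypothesis sigma_ge : forall n, (0 < n)%N ->
  c1 * expR (- neglog_rate alpha beta n) <= sigma n.-1.
Hypothesis sigma_le : forall n, (0 < n)%N ->
  sigma n.-1 <= c2 * expR (- neglog_rate alpha beta n).

Let s_gt0 : forall k, 0 < sigma k := sigma_gt0 c1_gt0 sigma_ge.

Context d (T : measurableType d) (P : probability T R).
Variable G : forall n : nat, 'I_n -> nat -> {RV P >-> R}.
Hypothesis hG : forall n : nat, gaussian_matrix (@G n).

(** [x] is 1 above the critical exponent and ln(n + 1) at it. The lower bound [x0] lets the terms of
    order sigma_(n+1), from the cut at k and from the bad event, be compared with the rate. *)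
Lemma expected_radius_le_rate (x : nat -> R) (x0 C4 : R) : 0 < x0 -> 0 < C4 ->
  (forall n, (0 < n)%N -> x0 <= x n) ->
  (forall n L, (0 < n)%N ->
     \sum_(l < L) 2 ^+ l * sigma (n * 2 ^ l)%N ^+ 2 <= C4 * (sigma n ^+ 2 * x n)) ->
  preccurly (fun n => expected_radius sigma (@G n))
    (fun n => (sigma n * Num.sqrt (x n))%:E).
Proof.
move=> x00 C40 hx hS.
have [c [C [del [K [c0 C0 del0 K0 H]]]]] := gaussian_blocks R.
have [D D0 hD] := sigma_comparable alpha_ge0 c1_gt0 c2_gt0 sigma_ge sigma_le K0.
have [E E0 hE] := sigma_ge_exp alpha_ge0 c1_gt0 sigma_ge del0.
(* The quantity under the root in [radius_le_blocks], relative to sigma_(n+1)^2 x_n: D^2 / x0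
   accounts for sigma_(k+1)^2 and C4 for the dyadic sum. *)
pose M := 4 * (C * K%:R / c * (D ^+ 2 / x0 + C4) + D ^+ 2 / x0).
have KR : 0 < K%:R :> R by rewrite ltr0n.
have M0 : 0 < M.
  rewrite /M mulr_gt0// addr_gt0 ?divr_gt0 ?exprn_gt0//.
  by rewrite mulr_gt0 ?addr_gt0 ?divr_gt0 ?mulr_gt0 ?exprn_gt0.
exists (Num.sqrt M + sigma 0%N * (8 * E) / Num.sqrt x0).
  rewrite addr_gt0 ?sqrtr_gt0// divr_gt0 ?sqrtr_gt0// mulr_gt0//.
  by rewrite mulr_gt0.
move=> n n0.
have [[A1 [mA1 PA1 _ h1]] [A2 [mA2 PA2 h2]]] := H _ T P n (@G n) n0 (hG n).
have xn := hx n n0; have xn0 : 0 < x n by exact: lt_le_trans xn.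
have sx : 0 < sigma n ^+ 2 * x n by rewrite mulr_gt0 ?exprn_gt0.
pose k := (n %/ K)%N.
have kn : (k <= n)%N by exact: leq_div.
have sk : sigma k <= D * sigma n.
  by apply: hD => //; rewrite mulnC; exact: ltn_ceil.
have sk2 : sigma k ^+ 2 <= D ^+ 2 / x0 * (sigma n ^+ 2 * x n).
  apply: (@le_trans _ _ ((D * sigma n) ^+ 2)).
    by rewrite lerXn2r ?nnegrE ?mulr_ge0 ?(ltW (s_gt0 _)) ?(ltW D0).
  rewrite exprMn -mulrA ler_pM2l ?exprn_gt0// ler_pdivlMl// mulrC.
  by rewrite ler_pM2l ?exprn_gt0.
pose B := Num.sqrt (4 * (C * (K * n)%:R * (sigma k ^+ 2 + C4 * (sigma n ^+ 2 * x n))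
  / (c * n%:R) + sigma k ^+ 2)).
have BM : B <= Num.sqrt M * (sigma n * Num.sqrt (x n)).
  rewrite -[sigma n]ger0_norm ?(ltW (s_gt0 _))// -[`|_|]sqrtr_sqr.
  rewrite -sqrtrM ?sqr_ge0// -sqrtrM ?(ltW M0)// ler_wsqrtr//.
  rewrite /M -[leRHS]mulrA ler_pM2l// natrM.
  have -> : C * (K%:R * n%:R) * (sigma k ^+ 2 + C4 * (sigma n ^+ 2 * x n)) / (c * n%:R) =
      C * K%:R / c * (sigma k ^+ 2 + C4 * (sigma n ^+ 2 * x n)).
    by field; rewrite gt_eqF//= pnatr_eq0 -lt0n.
  rewrite [leRHS]mulrDl; apply: lerD => //; rewrite -[leRHS]mulrA ler_pM2l ?divr_gt0 ?mulr_gt0//.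
  by rewrite mulrDl lerD2r.
have mA : measurable (A1 `|` A2) by exact: measurableU.
have PA : (P (A1 `|` A2) <= (8 * expR (- del * n%:R))%:E)%E.
  apply: le_trans (measureU2 _ mA1 mA2) _; apply: le_trans (leeD PA1 PA2) _.
  by rewrite -EFinD lee_fin; lra.
apply: le_trans (expected_radius_le s_gt0 sigma_ninc mA (sqrtr_ge0 _ : 0 <= B) _) _.
  move=> w Aw.
  have [hu hl] : _ /\ _ := h1 w (fun h => Aw (or_introl h)).
  have hr := h2 w (fun h => Aw (or_intror h)).
  apply: (@radius_le_blocks _ _ sigma (fun i j => G i j w) s_gt0 sigma_ninc (K * n)%N k c C) => //.
  - by rewrite muln_gt0 K0.
  - by apply: leq_trans kn _; rewrite leq_pmull.
  - by move=> l v; have /andP[] := hl l v.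
  - move=> L; apply: le_trans (hS n L n0).
    exact: (dyadic_sum_mono c1_gt0 sigma_ninc sigma_ge).
apply: (@le_trans _ _ (B%:E + (sigma 0%N)%:E * (8 * expR (- del * n%:R))%:E)%E).
  by rewrite leeD2l// lee_wpmul2l// lee_fin ltW.
rewrite -!EFinM -EFinD lee_fin [leRHS]mulrDl; apply: lerD => //.
apply: (@le_trans _ _ (sigma 0%N * (8 * (E * sigma n)))).
  by rewrite ler_pM2l// ler_pM2l.
have -> : sigma 0%N * (8 * E) / Num.sqrt x0 * (sigma n * Num.sqrt (x n)) =
  sigma 0%N * (8 * (E * sigma n)) * (Num.sqrt (x n) / Num.sqrt x0) by ring.
rewrite ler_peMr ?mulr_ge0 ?(ltW (s_gt0 _)) ?(ltW E0)//.
by rewrite ler_pdivlMr ?sqrtr_gt0// mul1r ler_wsqrtr.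
Qed.

Lemma expected_radius_ge_dyadic : exists (C : R) (K : nat), [/\ 0 < C, (0 < K)%N &
  forall (n L : nat) (t : R), (0 < n)%N -> 0 <= t ->
  let S := \sum_(l < L) 2 ^+ l * sigma (K * n * 2 ^ l.+1)%N ^+ 2 in
  0 < S -> t ^+ 2 * (sigma 0%N ^- 2 + C / S) <= 1 ->
  ((t / 2)%:E <= expected_radius sigma (@G n))%E].
Proof.
have [c [C [del [K [c0 C0 del0 K0 H]]]]] := gaussian_blocks R.
exists (C / c), K; split=> //; first by rewrite divr_gt0.
move=> n L t n0 t0 S S0 ht.
have [[A [mA _ PA h]] _] := H _ T P n (@G n) n0 (hG n).
apply: (expected_radius_ge s_gt0 sigma_ninc mA t0 PA) => w /h[hu hl].
have Kn0 : (0 < K * n)%N by rewrite muln_gt0 K0.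
have KnR : 0 < (K * n)%:R :> R by rewrite ltr0n.
apply: (@radius_ge_gram _ _ sigma (fun i j => G i j w) s_gt0 sigma_ninc (K * n)%N
  (K * n * 2 ^ L)%N (C * (K * n)%:R) (c * (K * n)%:R * S)) => //.
- by rewrite leq_pmulr// expn_gt0.
- move=> v; apply: (@dyadic_sum_ge _ (fun j => sigma j ^+ 2)
    (fun j => (\sum_i v i * G i j w) ^+ 2)) => //.
  + by move=> j; exact: sqr_ge0.
  + by move=> i j ij; rewrite lerXn2r ?nnegrE ?(ltW (s_gt0 _))//; exact: sigma_ninc.
  + by move=> j; exact: sqr_ge0.
  + by move=> l _; have /andP[] := hl l v.
- by rewrite !mulr_gt0.
- by rewrite mulr_ge0// ltW.
- move: ht; have -> // : C * (K * n)%:R / (c * (K * n)%:R * S) = C / c / S.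
  move: S0 KnR; move: S (_%:R) => S' x S0 x0.
  by field; rewrite !gt_eqF.
Qed.

(** The first coordinate is tau s, with s the claimed rate: s^2 / sigma_1^2 <= Y / sigma_1^2 and s^2
    C / S <= C / c4 add up to at most Q = 1 / tau^2. *)
Lemma expected_radius_ge_rate (x : nat -> R) (Y : R) : 0 < Y ->
  (forall n, (0 < n)%N -> 0 < x n) ->
  (forall n, (0 < n)%N -> sigma n ^+ 2 * x n <= Y) ->
  (forall K, (0 < K)%N -> exists2 c4 : R, 0 < c4 & forall n, (0 < n)%N -> exists L,
     c4 * (sigma n ^+ 2 * x n) <= \sum_(l < L) 2 ^+ l * sigma (K * n * 2 ^ l.+1)%N ^+ 2) ->
  preccurly (fun n => (sigma n * Num.sqrt (x n))%:E)
    (fun n => expected_radius sigma (@G n)).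
Proof.
move=> Y0 x0 hY hS.
have [C [K [C0 K0 H]]] := expected_radius_ge_dyadic.
have [c4 c40 h4] := hS K K0.
pose Q := Y / sigma 0%N ^+ 2 + C / c4.
have Q0 : 0 < Q by rewrite addr_gt0 ?divr_gt0 ?exprn_gt0.
pose tau := Num.sqrt Q^-1.
have tau0 : 0 < tau by rewrite sqrtr_gt0 invr_gt0.
have tau2 : tau ^+ 2 = Q^-1 by rewrite sqr_sqrtr// invr_ge0 ltW.
exists (2 / tau); first by rewrite divr_gt0.
move=> n n0; have [L hL] := h4 n n0.
have sx : 0 < sigma n ^+ 2 * x n by rewrite mulr_gt0 ?exprn_gt0 ?x0.
set s := sigma n * Num.sqrt (x n).
have s2 : s ^+ 2 = sigma n ^+ 2 * x n by rewrite exprMn sqr_sqrtr// ltW ?x0.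
have s0 : 0 <= s by rewrite mulr_ge0 ?sqrtr_ge0 ?ltW.
have := H n L (tau * s) n0 (mulr_ge0 (ltW tau0) s0) (lt_le_trans (mulr_gt0 c40 sx) hL).
move: hL; move: (\sum_(l < L) _) => Sg hL.
have Sg0 : 0 < Sg by exact: lt_le_trans (mulr_gt0 c40 sx) hL.
have -> : (tau * s) ^+ 2 * (sigma 0%N ^- 2 + C / Sg) <= 1.
  rewrite exprMn tau2 s2 -mulrA ler_pdivrMl// mulr1 mulrDr.
  apply: lerD; first by rewrite ler_pM2r ?invr_gt0 ?exprn_gt0// hY.
  rewrite mulrCA ler_pM2l// ler_pdivrMr// ler_pdivlMl//.
move=> /(_ isT) h.
have -> : s%:E = ((2 / tau)%:E * (tau * s / 2)%:E)%E.
  by rewrite -EFinM; congr EFin; field; rewrite gt_eqF.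
by apply: lee_wpmul2l => //; rewrite lee_fin ltW// divr_gt0.
Qed.

Lemma expected_radius_ge_first :
  alpha < 2^-1 \/ (beta <= alpha /\ alpha = 2^-1) ->
  preccurly (fun=> (sigma 0%N)%:E) (fun n => expected_radius sigma (@G n)).
Proof.
move=> hab; have [C [K [C0 K0 H]]] := expected_radius_ge_dyadic.
exists 4 => // n n0; have s0 := s_gt0 0.
(* [L] may depend on [n]. Once the dyadic sum exceeds C sigma_1^2, the coordinate sigma_1 / 2 is
   admissible; the constant 4 is 2 from this choice times 2 from the probability. *)
have [L hL] := dyadic_sum_unbounded alpha_ge0 c1_gt0 c2_gt0 sigma_ge sigma_le
  (C * sigma 0%N ^+ 2) K0 n0 hab.
have B0 : 0 < C * sigma 0%N ^+ 2 by rewrite mulr_gt0 ?exprn_gt0.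
have := H n L (sigma 0%N / 2) n0 (ltW (divr_gt0 s0 (ltr0n R 2))) (lt_le_trans B0 hL).
move: hL; move: (\sum_(l < L) _) => Sg hL.
have Sg0 : 0 < Sg by exact: lt_le_trans hL.
have -> : (sigma 0%N / 2) ^+ 2 * (sigma 0%N ^- 2 + C / Sg) <= 1.
  apply: (@le_trans _ _ ((sigma 0%N / 2) ^+ 2 * (sigma 0%N ^- 2 + sigma 0%N ^- 2))).
    rewrite ler_wpM2l ?sqr_ge0// lerD2l ler_pdivrMr// mulrC.
    by rewrite ler_pdivlMr ?exprn_gt0.
  have -> : (sigma 0%N / 2) ^+ 2 * (sigma 0%N ^- 2 + sigma 0%N ^- 2) = 2^-1.
    by field; rewrite gt_eqF.
  by lra.
move=> /(_ isT) h.
have -> : (sigma 0%N)%:E = (4%:E * (sigma 0%N / 2 / 2)%:E)%E.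
  by rewrite -EFinM; congr EFin; field.
by apply: lee_wpmul2l => //; rewrite lee_fin.
Qed.

End radius_asymptotics.

Lemma expR_neglog_rate (R : realType) (alpha beta : R) (n : nat) : (0 < n)%N ->
  expR (- neglog_rate alpha beta n) =
  n%:R `^ (- alpha) * ln n.+1%:R `^ (- beta).
Proof.
move=> n0; rewrite -[n%:R in RHS]lnK ?posrE ?ltr0n// -expRM.
rewrite -[ln n.+1%:R in RHS]lnK ?posrE ?ln_natr_gt0// -expRM -expRD.
by congr expR; rewrite /neglog_rate; ring.
Qed.

Theorem corollary7 (R : realType) (d : measure_display) (T : measurableType d)
    (P : probability T R)
    (G : forall n : nat, 'I_n -> nat -> {RV P >-> R})
    (hG : forall n : nat, gaussian_matrix (G n))
    (sigma : nat -> R) (alpha beta : R)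
    (sigma_ge0 : forall j : nat, 0 <= sigma j)
    (sigma_noninc : nonincreasing_seq sigma)
    (alpha_ge0 : 0 <= alpha) (beta_ge0 : alpha = 0 -> 0 <= beta)
    (hsigma : asymp (fun n => (sigma n.-1)%:E)
       (fun n => (n%:R `^ (- alpha) * ln (n.+1)%:R `^ (- beta))%:E)) :
  [/\ alpha < 2^-1 \/ (beta <= alpha /\ alpha = 2^-1) ->
        asymp (fun n => expected_radius sigma (G n)) (fun=> (sigma 0%N)%:E),
      alpha < beta /\ alpha = 2^-1 ->
        asymp (fun n => expected_radius sigma (G n))
          (fun n => (sigma n * Num.sqrt (ln (n.+1)%:R))%:E)
    & 2^-1 < alpha ->
        asymp (fun n => expected_radius sigma (G n)) (fun n => (sigma n)%:E)].
Proof.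
have [[c2 c20 h2] [c c0 h1]] := hsigma.
have sle n : (0 < n)%N -> sigma n.-1 <= c2 * expR (- neglog_rate alpha beta n).
  by move=> n0; rewrite expR_neglog_rate// -lee_fin EFinM; exact: h2.
have ci0 : 0 < c^-1 by rewrite invr_gt0.
have sge n : (0 < n)%N -> c^-1 * expR (- neglog_rate alpha beta n) <= sigma n.-1.
  by move=> n0; rewrite expR_neglog_rate// ler_pdivrMl// -lee_fin EFinM; exact: h1.
have s0 := sigma_gt0 ci0 sge.
split=> [h1'|[ab aE]|ha].
- split; last exact: (expected_radius_ge_first alpha_ge0 ci0 c20 sigma_noninc sge sle hG).
  exists 1 => // n n0; rewrite mul1e.
  have := @expected_radius_le _ _ _ P sigma s0 sigma_noninc n (G n) set0 (sigma 0%N)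
    measurable0 (sigma_ge0 0%N) (fun w _ => radius_le_first s0 sigma_noninc _).
  by rewrite measure0 mule0 adde0.
- have b2 : 2^-1 < beta by rewrite -aE.
  split.
    have [C C0 hC] := dyadic_sum_le_critical alpha_ge0 ci0 c20 sigma_noninc sge sle aE b2.
    apply: (expected_radius_le_rate alpha_ge0 ci0 c20 sigma_noninc sge sle hG (ln2_gt0 R) C0).
      by move=> n; exact: ln_natr_ge_ln2.
    exact: hC.
  have [Y Y0 hY] := sigma_sqr_ln_bounded ci0 c20 sigma_noninc sge sle aE b2.
  apply: (expected_radius_ge_rate ci0 sigma_noninc sge hG Y0) => // [n|K K0].
    exact: ln_natr_gt0.
  exact: (dyadic_sum_ge_critical alpha_ge0 ci0 c20 sigma_noninc sge sle aE b2 K0).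
- have E n : (sigma n)%:E = (sigma n * Num.sqrt 1)%:E by rewrite sqrtr1 mulr1.
  have [C C0 hC] := dyadic_sum_le_polynomial alpha_ge0 ci0 c20 sigma_noninc sge sle ha.
  rewrite (funext E); split.
    apply: (expected_radius_le_rate (x := fun=> 1) alpha_ge0 ci0 c20 sigma_noninc sge sle hG ltr01 C0) => //.
    by move=> n L n0; rewrite mulr1; exact: hC.
  apply: (expected_radius_ge_rate (x := fun=> 1) (Y := sigma 0%N ^+ 2) ci0 sigma_noninc sge hG) => //.
  - by rewrite exprn_gt0.
  - by move=> n n0; rewrite mulr1 lerXn2r ?nnegrE//; exact: sigma_noninc.
  - move=> K K0.
    have K4 : (0 < 4 * K)%N by rewrite muln_gt0.
    have [D D0 hD] := sigma_comparable alpha_ge0 ci0 c20 sge sle K4.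
    exists (D ^- 2); first by rewrite invr_gt0 exprn_gt0.
    (* The single term l = 0 already has the order sigma_(n+1)^2. *)
    move=> n n0; exists 1%N; rewrite big_ord1 expr0 mul1r mulr1 expn1.
    rewrite ler_pdivrMl ?exprn_gt0// -exprMn lerXn2r ?nnegrE ?mulr_ge0 ?(ltW D0)//.
    have Kn : (n <= K * n)%N by rewrite leq_pmull.
    by apply: hD; [|rewrite -mulnA mulnS]; lia.
Qed.
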